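(* Let $\Lambda_+^a\in(0,10)$ and $\Lambda_-^o\le\Lambda_+^o$ with $\Lambda_\pm^o\in(12,60)$ be independent of $h$, and set $\eta_+^a:=(\Lambda^a)^{-1}(\Lambda_+^a)$, $\eta_\pm^o:=(\Lambda^o)^{-1}(\Lambda_\pm^o)$. Let $\mathcal{S}_h:=\mathcal{T}_h\times\mathcal{T}_h$, where $$\mathcal{T}_h:=\mathrm{span}\{\varphi_h^{a,k}:\ 1\le k\le N,\ k\pi h\le\eta_+^a\}\oplus\mathrm{span}\{\varphi_h^{o,k}:\ 1\le k\le N,\ \eta_+^o\le k\pi h\le\eta_-^o\}\subset\mathbb{C}^{2N+1}.$$ Let $$T>T^\star:=\frac{2}{\min\Big\{\min_{\eta\in[0,\eta_+^a]}\partial_\eta\lambda^a(\eta),\ \min_{\eta\in[\eta_+^o,\eta_-^o]}(-\partial_\eta\lambda^o(\eta))\Big\}}.$$ Then there exists a constant $C(T)>0$, independent of $h=1/(N+1)$ and of the initial data, such that for all $(\mathbf{U}_h^0,\mathbf{U}_h^1)\in\mathcal{S}_h$ the corresponding solution $\mathbf{U}_h(t)$ of the discrete adjoint system satisfies $$\mathcal{E}_h(\mathbf{U}_h^0,\mathbf{U}_h^1)\le C(T)\int_0^T\|B_h\mathbf{U}_h(t)\|_{\mathbb{C}^{2N+1}}^2\,dt=C(T)\int_0^T\Big|\frac{U_N(t)}{h}\Big|^2dt.$$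
   Context: Discretization. Let $N\in\mathbb{N}$, $N\ge1$, $h=1/(N+1)$, $x_j=jh$ $(0\le j\le N+1)$, $x_{j+1/2}=(j+1/2)h$ $(0\le j\le N)$, $I_j=(x_j,x_{j+1})$. Basis of the continuous piecewise quadratic functions vanishing at $0$ and $1$: for $1\le j\le N$, $\phi_j(x)=\frac{2}{h^2}(x-x_{j-1/2})(x-x_{j-1})$ on $I_{j-1}$, $\phi_j(x)=\frac{2}{h^2}(x-x_{j+1/2})(x-x_{j+1})$ on $I_j$, $0$ elsewhere; for $0\le j\le N$, $\phi_{j+1/2}(x)=-\frac{4}{h^2}(x-x_j)(x-x_{j+1})$ on $I_j$, $0$ elsewhere. Vectors of $\mathbb{C}^{2N+1}$ are written $\mathbf{F}_h=(F_{j/2})_{1\le j\le 2N+1}$ with the convention $F_0=F_{N+1}=0$. The mass and stiffness matrices are $(M_h)_{ij}=\int_0^1\phi_{i/2}\phi_{j/2}\,dx$ and $(S_h)_{ij}=\int_0^1\phi_{i/2}'\phi_{j/2}'\,dx$, $1\le i,j\le 2N+1$. Norms: $\|\mathbf{F}_h\|_{h,1}^2=(S_h\mathbf{F}_h,\mathbf{F}_h)_{\mathbb{C}^{2N+1}}$, $\|\mathbf{F}_h\|_{h,0}^2=(M_h\mathbf{F}_h,\mathbf{F}_h)_{\mathbb{C}^{2N+1}}$. Adjoint system: $M_h\mathbf{U}_{h,tt}(t)+S_h\mathbf{U}_h(t)=0$, $\mathbf{U}_h(T)=\mathbf{U}_h^0$, $\mathbf{U}_{h,t}(T)=\mathbf{U}_h^1$.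 Its conserved energy is $\mathcal{E}_h(\mathbf{U}_h^0,\mathbf{U}_h^1)=\frac12(\|\mathbf{U}_h(t)\|_{h,1}^2+\|\mathbf{U}_{h,t}(t)\|_{h,0}^2)$. The observation matrix $B_h$ is the $(2N+1)\times(2N+1)$ matrix whose only nonzero entry is $-1/h$ at position $(2N+1,2N)$; thus the only nontrivial component of $B_h\mathbf{U}_h$ is the last one, $-U_N/h$, where $U_N$ is the component of $\mathbf{U}_h$ at the node $x_N$. Spectrum. For $\eta\in[0,\pi]$ let $\Delta(\eta)=1+268\cos^2(\eta/2)-44\cos^4(\eta/2)$, $$\Lambda^a(\eta)=\frac{120\sin^2(\eta/2)}{11+4\cos^2(\eta/2)+\sqrt{\Delta(\eta)}},\qquad \Lambda^o(\eta)=\frac{22+8\cos^2(\eta/2)+2\sqrt{\Delta(\eta)}}{1+\sin^2(\eta/2)},$$ and $\lambda^\alpha(\eta)=\sqrt{\Lambda^\alpha(\eta)}$, $\alpha\in\{a,o\}$ (derivatives at endpoints are one-sided). $\Lambda^a$ is a strictly increasing bijection $[0,\pi]\to[0,10]$ and $\Lambda^o$ is a strictly decreasing bijection $[0,\pi]\to[12,60]$. For $1\le k\le N$ put $\Lambda^{\alpha,k}=\Lambda^\alpha(k\pi h)$. The acoustic ($\alpha=a$) and optic ($\alpha=o$) eigenvectors $\tilde\varphi_h^{\alpha,k}$ of $S_h\varphi=h^{-2}\Lambda^{\alpha,k}M_h\varphi$ have components $\tilde\varphi_j^{\alpha,k}=\sin(k\pi x_j)$, $\tilde\varphi_{j+1/2}^{\alpha,k}=\frac{40+\Lambda^{\alpha,k}}{4(10-\Lambda^{\alpha,k})}\cos(\frac{k\pi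 h}{2})\sin(k\pi x_{j+1/2})$, and $\varphi_h^{\alpha,k}=\tilde\varphi_h^{\alpha,k}/\|\tilde\varphi_h^{\alpha,k}\|_{h,0}$. *)

(* Defs.v *)
From HB Require Import structures.
From mathcomp Require Import all_boot all_order all_algebra.
From mathcomp Require Import all_classical all_reals all_analysis.
From mathcomp Require Import complex.

Set Implicit Arguments.
Unset Strict Implicit.
Unset Printing Implicit Defensive.

Import Order.TTheory GRing.Theory Num.Theory.
Import numFieldNormedType.Exports.

Local Open Scope classical_set_scope.
Local Open Scope ring_scope.
Local Open Scope complex_scope.

(* Derivatives relative to a set: one-sided at the endpoints of an interval,
   two-sided in its interior. *)
Section DerivativesOnASet.
Context {R : realType}.
Implicit Types (A : set R) (x : R).

Definition is_deriv_on A (f : R -> R) x (l : R) : Prop :=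
  (f y - f x) / (y - x) @[y --> within A x^'] --> l.

Definition deriv_on A (f : R -> R) x : R :=
  lim ((f y - f x) / (y - x) @[y --> within A x^']).

Definition is_cderiv_on A (f : R -> R[i]) x (l : R[i]) : Prop :=
  is_deriv_on A (fun y => complex.Re (f y)) x (complex.Re l) /\
  is_deriv_on A (fun y => complex.Im (f y)) x (complex.Im l).

End DerivativesOnASet.

Section FiniteElements.
Variables (R : realType) (N : nat).

Local Notation mu := (@lebesgue_measure R).

Definition mesh : R := (N.+1%:R)^-1.

(* The half-integer index m/2 is encoded by the natural number m:
   [node m] is x_{m/2} and [phi m] is phi_{m/2}. *)
Definition node (m : nat) : R := m%:R / 2 * mesh.

Definition phi (m : nat) (x : R) : R :=
  if odd m then
    if node m.-1 <= x <= node m.+1 then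
      - (4 / mesh ^+ 2) * (x - node m.-1) * (x - node m.+1)
    else 0
  else
    if node m.-2 <= x <= node m then
      2 / mesh ^+ 2 * (x - node m.-1) * (x - node m.-2)
    else if node m <= x <= node m.+2 then
      2 / mesh ^+ 2 * (x - node m.+1) * (x - node m.+2)
    else 0.

(* C^{2N+1}; the component F_{m/2}, 1 <= m <= 2N+1, has ordinal index m - 1. *)
Definition vec := 'cV[R[i]]_(N.*2.+1).

Definition massR : 'M[R]_(N.*2.+1) :=
  \matrix_(i, j) \int[mu]_(x in `[0, 1]) (phi i.+1 x * phi j.+1 x).

(* phi_{m/2} is not differentiable at (at most three) nodes; the value of
   [derive1] on this null set does not affect the integral. *)
Definition stiffR : 'M[R]_(N.*2.+1) :=
  \matrix_(i, j)
    \int[mu]_(x in `[0, 1]) (derive1 (phi i.+1) x * derive1 (phi j.+1) x).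

Definition mass : 'M[R[i]]_(N.*2.+1) := map_mx (real_complex R) massR.

Definition stiff : 'M[R[i]]_(N.*2.+1) := map_mx (real_complex R) stiffR.

Definition dotc (F G : vec) : R[i] := \sum_i F i 0 * conjc (G i 0).

(* The three Hermitian forms below are real and nonnegative on the diagonal. *)
Definition norm_euclid (F : vec) : R := Num.sqrt (complex.Re (dotc F F)).
Definition norm_h1 (F : vec) : R := Num.sqrt (complex.Re (dotc (stiff *m F) F)).
Definition norm_h0 (F : vec) : R := Num.sqrt (complex.Re (dotc (mass *m F) F)).

(* U0 and U1 are the position and the velocity at the final time T. *)
Definition adjoint_solution (T : R) (U0 U1 : vec) (U : R -> vec) : Prop :=
  exists Ut Utt : R -> vec,
    [/\ forall t, t \in `[0, T] -> forall i,
          is_cderiv_on `[0, T] (fun s => U s i 0) t (Ut t i 0) /\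
          is_cderiv_on `[0, T] (fun s => Ut s i 0) t (Utt t i 0),
        forall t, t \in `[0, T] -> mass *m Utt t + stiff *m U t = 0,
        U T = U0
      & Ut T = U1].

(* The energy is conserved, hence given by its value at time T. *)
Definition energy (U0 U1 : vec) : R :=
  2^-1 * (norm_h1 U0 ^+ 2 + norm_h0 U1 ^+ 2).

Definition obs : 'M[R[i]]_(N.*2.+1) :=
  \matrix_(i, j)
    if (i.+1 == N.*2.+1) && (j.+1 == N.*2) then - (mesh^-1)%:C else 0.

(* U_N = U_{2N/2}; meaningful for N >= 1. *)
Definition last_node (U : vec) : R[i] := U (inord N.*2.-1) 0.

End FiniteElements.

Section Spectrum.
Context {R : realType}.
Implicit Types eta : R.

Definition Delta eta : R :=
  1 + 268 * cos (eta / 2) ^+ 2 - 44 * cos (eta / 2) ^+ 4.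

Definition Lambda_a eta : R :=
  120 * sin (eta / 2) ^+ 2 /
  (11 + 4 * cos (eta / 2) ^+ 2 + Num.sqrt (Delta eta)).

Definition Lambda_o eta : R :=
  (22 + 8 * cos (eta / 2) ^+ 2 + 2 * Num.sqrt (Delta eta)) /
  (1 + sin (eta / 2) ^+ 2).

Definition lambda_a eta : R := Num.sqrt (Lambda_a eta).
Definition lambda_o eta : R := Num.sqrt (Lambda_o eta).

Definition Lambda_a_inv : R -> R := 'pinv_(fun=> 0) `[0, pi] Lambda_a.
Definition Lambda_o_inv : R -> R := 'pinv_(fun=> 0) `[0, pi] Lambda_o.

(* The infima are minima of continuous functions over compact intervals. *)
Definition Tstar (eta_a eta_om eta_op : R) : R :=
  2 / Num.min
    (inf [set deriv_on `[0, pi] lambda_a eta | eta in `[0, eta_a]])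
    (inf [set - deriv_on `[0, pi] lambda_o eta | eta in `[eta_op, eta_om]]).

(* The k-th eigenvector, unnormalized then normalized, on the branch
   [Lambda] (= Lambda_a or Lambda_o). *)
Definition eigvec_tilde (Lambda : R -> R) (N k : nat) : vec R N :=
  let h := mesh R N in
  let L := Lambda (k%:R * pi * h) in
  \col_(i < N.*2.+1)
    (if odd i.+1 then
       (40 + L) / (4 * (10 - L)) * cos (k%:R * pi * h / 2) *
       sin (k%:R * pi * node R N i.+1)
     else sin (k%:R * pi * node R N i.+1))%:C.

Definition eigvec (Lambda : R -> R) (N k : nat) : vec R N :=
  ((norm_h0 (eigvec_tilde Lambda N k))^-1)%:C *: eigvec_tilde Lambda N k.

Definition trunc_space (N : nat) (eta_a eta_om eta_op : R) :
    {vspace 'cV[R[i]]_(N.*2.+1)} :=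
  let h := mesh R N in
  let acoustic := [seq k <- iota 1 N | (k%:R * pi * h <= eta_a)%R] in
  let optic := [seq k <- iota 1 N | (eta_op <= k%:R * pi * h <= eta_om)%R] in
  (<<map (eigvec Lambda_a N) acoustic>> + <<map (eigvec Lambda_o N) optic>>)%VS.

End Spectrum.

(* Main.v *)
(* Two eigenvalues of the same branch with wave numbers at distance [pi h] have
   frequencies [lambda / h] at distance at least [pi gamma], where [gamma] is the
   smallest group velocity on the truncated spectrum. The two branches stay apart
   as well: from the sum and the product of the two roots of the dispersion
   relation, [lambda_o - lambda_a >= pi h] at all wave numbers at most
   [pi - pi h], while [gamma <= 1] because the acoustic velocity is [1] at [0].
   So the whole family of frequencies, with both signs, has gap [pi gamma], for
   every mesh, and [T > 2 / gamma] is the condition of Ingham's inequality.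
   Ingham's inequality bounds the boundary amplitudes of the modes, and these
   control the energy since [Lambda = O (sin eta ^ 2)] on the truncated
   spectrum. The solution equals its modal expansion because the mass matrix is
   positive definite and the stiffness matrix positive semidefinite; real and
   imaginary parts are treated separately. *)

Require Import Defs.
From HB Require Import structures.
From mathcomp Require Import all_boot all_order all_algebra.
From mathcomp Require Import all_classical all_reals all_analysis.
From mathcomp Require Import complex ring lra zify.
From mathcomp Require Import measurable_realfun.

Set Implicit Arguments.
Unset Strict Implicit.
Unset Printing Implicit Defensive.

Import Order.TTheory GRing.Theory Num.Theory.
Import numFieldNormedType.Exports.

Local Open Scope classical_set_scope.
Local Open Scope ring_scope.
Local Open Scope complex_scope.

(** * One-variable calculus *)

(** The difficulty is uniformity down to the coarsest mesh. The bands [0,10] and [12,60] alone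
    separate [lambda_o] from [lambda_a] by sqrt 12 - sqrt 10, about 0.3, whereas [pi * h] reaches pi
    / 2 for N = 1. The missing room comes from the sampled wave numbers: they stay at distance
    [pi * h] from pi, the only place where the branches come that close. Ingham's inequality is
    needed with an explicit constant depending on T and the gap only. With the weight cos (pi / T *
    (t - T / 2)), the Gram matrix of the exponentials is diagonally dominant: its off-diagonal rows
    are bounded by sums of 1 / (4 x^2 - 1) over points x at mutual distance at least 1, and such
    sums telescope. The diagonal wins exactly when the gap exceeds 2 pi / T. The midpoint factor of
    the eigenvectors has a pole at Lambda = 10. The truncation keeps the acoustic eigenvalues below
    [La_p] < 10 and the optic ones are at least 12, so the factor is bounded independently of the
    mesh. *)

Section Calculus.
Variable R : realType.
Implicit Types (f g F : R -> R) (x a b : R).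

Lemma is_derive1D f g x a b : is_derive x 1 f a -> is_derive x 1 g b ->
  is_derive x 1 (fun y => f y + g y) (a + b).
Proof. exact: is_deriveD. Qed.

Lemma is_derive1B f g x a b : is_derive x 1 f a -> is_derive x 1 g b ->
  is_derive x 1 (fun y => f y - g y) (a - b).
Proof. exact: is_deriveB. Qed.

Lemma is_derive1M f g x a b : is_derive x 1 f a -> is_derive x 1 g b ->
  is_derive x 1 (fun y => f y * g y) (f x * b + g x * a).
Proof. exact: is_deriveM. Qed.

Lemma is_derive1Z f x (k : R) a : is_derive x 1 f a ->
  is_derive x 1 (fun y => k * f y) (k * a).
Proof. exact: is_deriveZ. Qed.

Lemma is_derive1X f n x a : is_derive x 1 f a ->
  is_derive x 1 (fun y => f y ^+ n) (n%:R * f x ^+ n.-1 * a).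
Proof.
move=> df; have := is_deriveX n df; rewrite (_ : f ^+ n = fun y => f y ^+ n) //.
by apply/funext => y; rewrite exprfctE.
Qed.

Lemma is_derive1_sum (I : Type) (r : seq I) (F : I -> R -> R) x (dF : I -> R) :
  (forall i, is_derive x 1 (F i) (dF i)) ->
  is_derive x 1 (fun y => \sum_(i <- r) F i y) (\sum_(i <- r) dF i).
Proof.
move=> dFx; elim: r => [|i r IH].
  rewrite big_nil (_ : (fun _ => _) = cst 0); last first.
    by apply/funext => y; rewrite big_nil.
  exact: is_derive_cst.
rewrite big_cons (_ : (fun _ => _) = (fun y => F i y + \sum_(j <- r) F j y)).
  exact: is_derive1D.
by apply/funext => y; rewrite big_cons.
Qed.

Lemma is_derive1_affine x (k c : R) : is_derive x 1 (fun y => k * (y - c)) k.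
Proof.
rewrite -[X in is_derive _ _ _ X]mulr1; apply: is_derive1Z.
rewrite -[X in is_derive _ _ _ X](subr0 1).
exact: (@is_derive1B id (cst c)).
Qed.

Lemma is_derive1_cos_affine x (k c : R) :
  is_derive x 1 (fun y => cos (k * (y - c))) (- (k * sin (k * (x - c)))).
Proof.
by rewrite mulrC -mulNr; apply: (is_derive1_comp (f := cos)); exact: is_derive1_affine.
Qed.

Lemma is_derive1_sin_affine x (k c : R) :
  is_derive x 1 (fun y => sin (k * (y - c))) (k * cos (k * (x - c))).
Proof.
by rewrite mulrC; apply: (is_derive1_comp (f := sin)); exact: is_derive1_affine.
Qed.

Lemma is_derive1_continuous f (df : R -> R) :
  (forall x, is_derive x 1 f (df x)) -> continuous f.
Proof.
by move=> dfx x; apply: differentiable_continuous; apply/derivable1_diffP; case: (dfx x).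
Qed.

Lemma continuous1D f g : continuous f -> continuous g ->
  continuous (fun t => f t + g t).
Proof. by move=> cf cg x; exact: continuousD (cf x) (cg x). Qed.

Lemma continuous1B f g : continuous f -> continuous g ->
  continuous (fun t => f t - g t).
Proof. by move=> cf cg x; exact: continuousB (cf x) (cg x). Qed.

Lemma continuous1M f g : continuous f -> continuous g ->
  continuous (fun t => f t * g t).
Proof. by move=> cf cg x; exact: continuousM (cf x) (cg x). Qed.

Lemma continuous1Z (k : R) f : continuous f -> continuous (fun t => k * f t).
Proof. by apply: continuous1M => x; exact: cst_continuous. Qed.

Lemma continuous1X f n : continuous f -> continuous (fun t => f t ^+ n).
Proof.
move=> cf; elim: n => [|n IH].
  rewrite (_ : (fun _ => _) = cst 1); first by move=> x; exact: cst_continuous.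
  by apply/funext => x; rewrite expr0.
rewrite (_ : (fun _ => _) = (fun x => f x * f x ^+ n)); first exact: continuous1M.
by apply/funext => x; rewrite exprS.
Qed.

Lemma continuous1_sum (I : Type) (r : seq I) (F : I -> R -> R) :
  (forall i, continuous (F i)) -> continuous (fun t => \sum_(i <- r) F i t).
Proof.
move=> cF; elim: r => [|i r IH].
  rewrite (_ : (fun _ => _) = cst 0); first by move=> x; exact: cst_continuous.
  by apply/funext => x; rewrite big_nil.
rewrite (_ : (fun _ => _) = (fun x => F i x + \sum_(j <- r) F j x)).
  exact: continuous1D.
by apply/funext => x; rewrite big_cons.
Qed.

Lemma continuous_cos_affine (k c : R) : continuous (fun t : R => cos (k * (t - c))).
Proof. exact: is_derive1_continuous (fun x => is_derive1_cos_affine x k c). Qed.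

Lemma continuous_sin_affine (k c : R) : continuous (fun t : R => sin (k * (t - c))).
Proof. exact: is_derive1_continuous (fun x => is_derive1_sin_affine x k c). Qed.

Lemma continuous_integrable_itv f a b : {within `[a, b], continuous f} ->
  (@lebesgue_measure R).-integrable `[a, b] (EFin \o f).
Proof.
by move=> cf; apply: continuous_compact_integrable => //; exact: segment_compact.
Qed.

Lemma Rintegral_FTC2 f F (a b : R) : a < b -> continuous f ->
  (forall x, is_derive x 1 F (f x)) ->
  \int[@lebesgue_measure R]_(x in `[a, b]) f x = F b - F a.
Proof.
move=> ab cf dF; rewrite /Rintegral (@continuous_FTC2 _ f F) //.
- exact: continuous_subspaceT.
- split; first by move=> x _; case: (dF x).
  + exact/cvg_at_right_filter/(is_derive1_continuous dF).
  + exact/cvg_at_left_filter/(is_derive1_continuous dF).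
- by move=> x _; rewrite derive1E; apply: derive_val.
Qed.

End Calculus.

(** * Ingham's inequality *)

Section Ingham.
Variable R : realType.

(* [(4 * x ^+ 2 - 1)^-1 = (4 * x - 2)^-1 - (4 * x + 2)^-1], and the intervals
   [x - 1/2, x + 1/2] do not overlap: the sum is dominated by a telescoping one. *)
Lemma packing_sum (I : finType) (x : I -> R) (A : {set I}) (X : R) :
    0 <= X -> {in A, forall i, 1 <= x i <= X} ->
    {in A &, forall i j, i != j -> 1 <= `|x i - x j|} ->
  \sum_(i in A) (4 * x i ^+ 2 - 1)^-1 <= 2^-1 - (4 * X + 2)^-1.
Proof.
have [n] := ubnP #|A|; elim: n => // n IH in A X * => /ltnSE cardA X0 xA sepA.
have [->|[i0 i0A]] := set_0Vmem A.
  rewrite big_set0 subr_ge0 lef_pV2 ?posrE; lra.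
(* Induction removes the largest point; by separation the others lie below [x i - 1], which becomes
   the new upper bound. *)
pose m := [arg max_(i > i0 in A) x i]%O.
have [i iA imax] : exists2 i, i \in A & {in A, forall j, x j <= x i}.
  by case: (@arg_maxP _ _ _ i0 (mem A) x i0A) => i iA imax; exists i.
rewrite (big_setD1 i) //=.
have /andP[xi1 xiX] := xA i iA.
have {}IH : \sum_(j in A :\ i) (4 * x j ^+ 2 - 1)^-1 <=
    2^-1 - (4 * (x i - 1) + 2)^-1.
  apply: IH.
  - by rewrite (cardsD1 i A) iA in cardA.
  - by rewrite subr_ge0.
  - move=> j /setD1P[ji jA]; have /andP[-> _] := xA j jA => /=.
    have := sepA _ _ iA jA; rewrite eq_sym ji => /(_ isT).
    by rewrite ger0_norm ?subr_ge0 ?imax //; lra.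
  - by move=> j l /setD1P[_ jA] /setD1P[_ lA]; exact: sepA.
apply: (le_trans (lerD (lexx _) IH)).
have le2 : (4 * X + 2)^-1 <= (4 * x i + 2)^-1 by rewrite lef_pV2 ?posrE; lra.
suff -> : (4 * x i ^+ 2 - 1)^-1 =
   (4 * (x i - 1) + 2)^-1 - (4 * x i + 2)^-1 by lra.
by field; rewrite !lt0r_neq0 //; nra.
Qed.

Lemma packing_sum_half (I : finType) (x : I -> R) (P : pred I) :
    (forall i, P i -> 1 <= x i) ->
    (forall i j, P i -> P j -> i != j -> 1 <= `|x i - x j|) ->
  \sum_(i | P i) (4 * x i ^+ 2 - 1)^-1 <= 2^-1.
Proof.
(* Any common upper bound [X] will do, since the limit 1/2 does not depend on it; the points being
   positive, their sum is one. *)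
move=> x1 sep; pose A := finset P; pose X := \sum_(i in A) x i.
have -> : \sum_(i | P i) (4 * x i ^+ 2 - 1)^-1 =
    \sum_(i in A) (4 * x i ^+ 2 - 1)^-1.
  by apply: eq_bigl => i; rewrite inE.
have X0 : 0 <= X.
  by apply: sumr_ge0 => i; rewrite inE => /x1; apply: le_trans.
apply: (@le_trans _ _ (2^-1 - (4 * X + 2)^-1)); last first.
  by rewrite gerBl invr_ge0 addr_ge0 // mulr_ge0.
apply: packing_sum => //.
- move=> i; rewrite inE => Pi; rewrite x1 //= /X (bigD1 i) ?inE //=.
  rewrite lerDl sumr_ge0 // => j /andP[]; rewrite inE => /x1 + _.
  exact: le_trans.
- by move=> i j; rewrite !inE => Pi Pj; exact: sep.
Qed.

(* The cosine transform of the weight [cos (pi / T * (t - T / 2))] on [0, T]. *)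
Definition trig_kernel (T s : R) : R :=
  ((pi / T + s)^-1 + (pi / T - s)^-1) * cos (s * (T / 2)).

Lemma trig_kernel0 (T : R) : 0 < T -> trig_kernel T 0 = 2 * T / pi.
Proof.
move=> T0; rewrite /trig_kernel mul0r cos0 addr0 subr0 mulr1 invf_div; lra.
Qed.

Lemma trig_kernelN (T s : R) : trig_kernel T (- s) = trig_kernel T s.
Proof. by rewrite /trig_kernel mulNr cosN opprK addrC. Qed.

(** Put a = pi / T. For s > a the kernel is at most 2 a / (s^2 - a^2) in absolute value. With x = s
    / g >= 1 and rho = (g / (2 a))^2 > 1, one has s^2 - a^2 = a^2 (4 rho x^2 - 1) >= a^2 rho (4 x^2
    - 1), which is the form that [packing_sum_half] can sum. *)
Lemma trig_kernel_le (T s g : R) : 0 < T -> 2 * pi < g * T -> g <= `|s| ->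
  `|trig_kernel T s| <=
    2 * T / pi / (g * T / (2 * pi)) ^+ 2 * (4 * (s / g) ^+ 2 - 1)^-1.
Proof.
move=> T0 gT.
wlog s0 : s / 0 <= s.
  move=> H; case: (leP 0 s) => [s0|s0] gs; first exact: H.
  rewrite -trig_kernelN; have := H (- s); rewrite normrN mulNr sqrrN; apply=> //.
  by rewrite oppr_ge0 ltW.
rewrite (ger0_norm s0) => gs.
have p0 : 0 < pi :> R := pi_gt0 R.
have g0 : 0 < g by rewrite -(pmulr_lgt0 _ T0); lra.
rewrite /trig_kernel; set a := pi / T; have a0 : 0 < a by rewrite divr_gt0.
have aT : pi = a * T by rewrite /a divfK // gt_eqF.
clearbody a.
have ga : 2 * a < g by move: gT; rewrite aT mulrA ltr_pM2r.
rewrite normrM.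
apply: (@le_trans _ _ `|(a + s)^-1 + (a - s)^-1|).
  by rewrite ler_piMr // cos_max.
have sa : a < s by lra.
have sa2 : 0 < s ^+ 2 - a ^+ 2 by rewrite subr_sqr mulr_gt0; lra.
have -> : (a + s)^-1 + (a - s)^-1 = - (2 * a / (s ^+ 2 - a ^+ 2)).
  have n1 : a - s != 0 by rewrite lt_eqF //; lra.
  have n2 : a + s != 0 by rewrite gt_eqF //; lra.
  by field; rewrite (gt_eqF sa2) n1 n2.
rewrite normrN ger0_norm; last first.
  exact: divr_ge0 (mulr_ge0 (ler0n _ 2) (ltW a0)) (ltW sa2).
set rho := (g * T / (2 * pi)) ^+ 2.
have rho1 : 1 < rho.
  by rewrite /rho expr_gt1 ?ltr_pdivlMr ?mul1r ?divr_ge0 ?mulr_ge0 //; lra.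
have rE : g ^+ 2 = 4 * a ^+ 2 * rho.
  by rewrite /rho aT; field; rewrite !gt_eqF.
have -> : 2 * T / pi = 2 / a by rewrite aT; field; rewrite !gt_eqF.
pose x := s / g; have x1 : 1 <= x by rewrite /x ler_pdivlMr ?mul1r.
have -> : s ^+ 2 = 4 * a ^+ 2 * rho * x ^+ 2.
  by rewrite -rE /x; field; rewrite gt_eqF.
rewrite -/x.
have x2 : 1 <= x ^+ 2 by rewrite expr_ge1 //; lra.
have x3 : 0 < 4 * x ^+ 2 - 1 by lra.
have rho0 : 0 < rho by lra.
have -> : 2 / a / rho * (4 * x ^+ 2 - 1)^-1 =
    2 * a / (a ^+ 2 * (rho * (4 * x ^+ 2 - 1))).
  by field; rewrite (gt_eqF a0) (gt_eqF rho0) gt_eqF.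
have a2 : 0 < a ^+ 2 by rewrite exprn_gt0.
rewrite ler_pM2l ?mulr_gt0 //.
have h : a ^+ 2 * (rho * (4 * x ^+ 2 - 1)) <=
    4 * a ^+ 2 * rho * x ^+ 2 - a ^+ 2.
  rewrite -subr_ge0 (_ : _ - _ = a ^+ 2 * (rho - 1)); last by ring.
  by rewrite mulr_ge0 ?(ltW a2) ?subr_ge0 ?(ltW rho1).
have h0 : 0 < a ^+ 2 * (rho * (4 * x ^+ 2 - 1)).
  exact: mulr_gt0 a2 (mulr_gt0 rho0 x3).
by rewrite lef_pV2 ?posrE ?(lt_le_trans h0 h).
Qed.

(** The diagonal entry [trig_kernel T 0] minus the bound of [trig_kernel_row_sum] on the rest of a
    row. *)
Definition ingham_const (T g : R) : R :=
  2 * T / pi * (1 - ((g * T / (2 * pi)) ^+ 2)^-1).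

Lemma ingham_const_gt0 (T g : R) : 0 < T -> 2 * pi < g * T ->
  0 < ingham_const T g.
Proof.
move=> T0 gT; have p0 : 0 < pi :> R := pi_gt0 R.
rewrite mulr_gt0 ?divr_gt0 ?mulr_gt0 // subr_gt0 invf_lt1.
  have h : 1 < g * T / (2 * pi) by rewrite ltr_pdivlMr ?mul1r //; lra.
  by rewrite expr_gt1 // ltW // (lt_trans ltr01).
by rewrite exprn_gt0 // divr_gt0 //; lra.
Qed.

Section GapFamily.
Variables (J : finType) (nu : J -> R) (T g : R).
Hypothesis T0 : 0 < T.
Hypothesis gT : 2 * pi < g * T.
Hypothesis gap : forall j l, j != l -> g <= `|nu j - nu l|.

(** The frequencies below [nu j] and those above it, measured from [nu j] in units of g, are two
    families of points at least 1 and at mutual distance at least 1; each contributes at most one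
    half. *)
Lemma trig_kernel_row_sum j :
  \sum_(l | l != j) `|trig_kernel T (nu j - nu l)| <=
    2 * T / pi / (g * T / (2 * pi)) ^+ 2.
Proof.
have p0 : 0 < pi :> R := pi_gt0 R.
have g0 : 0 < g by rewrite -(pmulr_lgt0 _ T0) (lt_trans _ gT) // mulr_gt0.
set k := 2 * T / pi / _.
have k0 : 0 <= k.
  by rewrite /k divr_ge0 ?sqr_ge0 // divr_ge0 ?(ltW p0) // mulr_ge0 ?(ltW T0).
apply: (@le_trans _ _
    (\sum_(l | l != j) k * (4 * ((nu j - nu l) / g) ^+ 2 - 1)^-1)).
  apply: ler_sum => l lj.
  by apply: trig_kernel_le => //; rewrite gap // eq_sym.
rewrite -mulr_sumr -[leRHS]mulr1 ler_wpM2l //.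
rewrite (bigID (fun l => nu l < nu j)) /=.
rewrite [leRHS](_ : 1 = 2^-1 + 2^-1); last by lra.
apply: lerD.
  apply: (packing_sum_half (x := fun l => (nu j - nu l) / g)) => [l|l m].
    move=> /andP[lj h]; rewrite ler_pdivlMr // mul1r.
    by have := gap lj; rewrite distrC ger0_norm // subr_ge0 ltW.
  move=> _ _ lm; rewrite -mulrBl normrM normfV (gtr0_norm g0).
  rewrite ler_pdivlMr // mul1r; have := gap lm; rewrite distrC.
  by congr (_ <= `|_|); lra.
under eq_bigr do rewrite -sqrrN -mulNr opprB.
apply: (packing_sum_half (x := fun l => (nu l - nu j) / g)) => [l|l m].
  move=> /andP[lj h]; rewrite ler_pdivlMr // mul1r.
  by have := gap lj; rewrite ger0_norm // subr_ge0 leNgt.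
move=> _ _ lm; rewrite -mulrBl normrM normfV (gtr0_norm g0).
rewrite ler_pdivlMr // mul1r; have := gap lm.
by congr (_ <= `|_|); lra.
Qed.

(** Diagonal dominance: |p_j p_l + q_j q_l| is at most the mean of the weights [w j] and [w l], and
    the kernel is symmetric, so each [w j] is charged with one off-diagonal row sum. *)
Lemma trig_gram_ge (p q : J -> R) :
  ingham_const T g * (\sum_j (p j ^+ 2 + q j ^+ 2)) <=
  \sum_j \sum_l (p j * p l + q j * q l) * trig_kernel T (nu j - nu l).
Proof.
pose w j : R := p j ^+ 2 + q j ^+ 2.
pose K j l : R := `|trig_kernel T (nu j - nu l)|.
have KC j l : K j l = K l j by rewrite /K -trig_kernelN opprB.
have w0 j : 0 <= w j by rewrite addr_ge0 ?sqr_ge0.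
have lower j l : - (2^-1 * (w j * K j l) + 2^-1 * (w l * K j l)) <=
    (p j * p l + q j * q l) * trig_kernel T (nu j - nu l).
  rewrite lerNl (le_trans (ler_norm _)) // normrN normrM -/(K j l).
  rewrite -mulrDr -mulrDl mulrA ler_wpM2r ?normr_ge0 // ler_norml /w.
  have := (sqr_ge0 (p j - p l), sqr_ge0 (q j - q l), sqr_ge0 (p j + p l),
    sqr_ge0 (q j + q l)).
  by move=> [[[h1 h2] h3] h4]; apply/andP; split; nra.
apply: (@le_trans _ _ (\sum_j (w j * (2 * T / pi) -
    \sum_(l | l != j) (2^-1 * (w j * K j l) + 2^-1 * (w l * K j l))))).
  rewrite sumrB; under [X in _ - X]eq_bigr do rewrite big_split /=.
  rewrite [X in _ - X]big_split /= [X in _ - (_ + X)](exchange_big_dep predT) //=.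
  have -> : \sum_j \sum_(i | j != i) 2^-1 * (w j * K i j) =
      \sum_j \sum_(l | l != j) 2^-1 * (w j * K j l).
    apply: eq_bigr => j _; apply: eq_big => [l|l _]; first by rewrite eq_sym.
    by rewrite KC.
  rewrite -big_split -sumrB /= mulr_sumr; apply: ler_sum => j _.
  rewrite -big_split /=.
  have half (y : R) : 2^-1 * y + 2^-1 * y = y by lra.
  under eq_bigr do rewrite half.
  rewrite -mulr_sumr -mulrBr mulrC ler_wpM2l ?w0 // /ingham_const mulrBr mulr1.
  by rewrite lerD2l lerN2 trig_kernel_row_sum.
apply: ler_sum => j _; rewrite [leRHS](bigD1 j) //= subrr trig_kernel0 //.
by rewrite -!expr2 lerD2l -sumrN ler_sum.
Qed.

End GapFamily.

(** Product-to-sum formula. The two conditions say that s does not resonate with the weight; for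
    differences of frequencies they follow from pi / T < g. *)
Lemma is_derive1_cos_cos (T s c : R) :
    pi / T + s != 0 -> pi / T - s != 0 ->
  forall x : R, is_derive x 1 (fun t => 2^-1 *
      ((pi / T + s)^-1 * sin ((pi / T + s) * (t - c)) +
       (pi / T - s)^-1 * sin ((pi / T - s) * (t - c))))
    (cos (pi / T * (x - c)) * cos (s * (x - c))).
Proof.
move=> n1 n2 x; set a := pi / T in n1 n2 *; clearbody a.
have -> : cos (a * (x - c)) * cos (s * (x - c)) =
    2^-1 * ((a + s)^-1 * ((a + s) * cos ((a + s) * (x - c))) +
            (a - s)^-1 * ((a - s) * cos ((a - s) * (x - c)))).
  rewrite !mulKf // !(mulrDl _ _ (x - c)) !mulNr !cosD !cosN !sinN; lra.
by apply: is_derive1Z; apply: is_derive1D; apply: is_derive1Z;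
  exact: is_derive1_sin_affine.
Qed.

Lemma is_derive1_cos_sin (T s c : R) :
    pi / T + s != 0 -> pi / T - s != 0 ->
  forall x : R, is_derive x 1 (fun t => 2^-1 *
      ((pi / T - s)^-1 * cos ((pi / T - s) * (t - c)) -
       (pi / T + s)^-1 * cos ((pi / T + s) * (t - c))))
    (cos (pi / T * (x - c)) * sin (s * (x - c))).
Proof.
move=> n1 n2 x; set a := pi / T in n1 n2 *; clearbody a.
have -> : cos (a * (x - c)) * sin (s * (x - c)) =
    2^-1 * ((a - s)^-1 * (- ((a - s) * sin ((a - s) * (x - c)))) -
            (a + s)^-1 * (- ((a + s) * sin ((a + s) * (x - c))))).
  rewrite !mulrN !mulKf // !(mulrDl _ _ (x - c)) !mulNr !sinD !cosN !sinN; lra.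
by apply: is_derive1Z; apply: is_derive1B; apply: is_derive1Z;
  exact: is_derive1_cos_affine.
Qed.


Section FrequencyFamily.
Variables (J : finType) (nu : J -> R).

(** Together with [trig_im], the real and imaginary parts of the sum of (p_j + i q_j) exp (i nu_j (t
    - c)). *)
Definition trig_re (c : R) (p q : J -> R) (t : R) : R :=
  \sum_j (p j * cos (nu j * (t - c)) - q j * sin (nu j * (t - c))).

Definition trig_im (c : R) (p q : J -> R) (t : R) : R :=
  \sum_j (p j * sin (nu j * (t - c)) + q j * cos (nu j * (t - c))).

Lemma continuous_trig_re c p q : continuous (trig_re c p q).
Proof.
apply: continuous1_sum => j; apply: continuous1B; apply: continuous1Z.
  exact: continuous_cos_affine.
exact: continuous_sin_affine.
Qed.

Lemma continuous_trig_im c p q : continuous (trig_im c p q).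
Proof.
apply: continuous1_sum => j; apply: continuous1D; apply: continuous1Z.
  exact: continuous_sin_affine.
exact: continuous_cos_affine.
Qed.

(** A change of origin multiplies each coefficient by the unit complex number exp (i nu_j (d - c)).
    It moves the origin to the centre T / 2 of the weight. *)
Lemma trig_rotate (c d t : R) (p q : J -> R) :
  let p' j := p j * cos (nu j * (d - c)) - q j * sin (nu j * (d - c)) in
  let q' j := p j * sin (nu j * (d - c)) + q j * cos (nu j * (d - c)) in
  [/\ trig_re c p q t = trig_re d p' q' t,
      trig_im c p q t = trig_im d p' q' t
    & \sum_j (p j ^+ 2 + q j ^+ 2) = \sum_j (p' j ^+ 2 + q' j ^+ 2)].
Proof.
have E j : nu j * (t - c) = nu j * (t - d) + nu j * (d - c) by ring.
move=> p' q'; split; apply: eq_bigr => j _.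
- by rewrite E cosD sinD /p' /q'; ring.
- by rewrite E cosD sinD /p' /q'; ring.
- rewrite /p' /q'; have := cos2Dsin2 (nu j * (d - c)).
  move: (cos _) (sin _) => C S h.
  transitivity ((p j ^+ 2 + q j ^+ 2) * (C ^+ 2 + S ^+ 2)); last by ring.
  by rewrite h mulr1.
Qed.

Lemma trig_sqr_expand (c : R) (p q : J -> R) (t : R) :
  trig_re c p q t ^+ 2 + trig_im c p q t ^+ 2 =
  \sum_j \sum_l ((p j * p l + q j * q l) * cos ((nu j - nu l) * (t - c)) +
                  (p j * q l - q j * p l) * sin ((nu j - nu l) * (t - c))).
Proof.
rewrite !expr2 /trig_re /trig_im !big_distrl /= -big_split /=.
apply: eq_bigr => j _; rewrite !big_distrr /= -big_split /=.
apply: eq_bigr => l _.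
by rewrite (mulrDl _ _ (t - c)) mulNr cosD sinD cosN sinN; ring.
Qed.

Variables (T g : R).
Hypothesis T0 : 0 < T.
Hypothesis gT : 2 * pi < g * T.
Hypothesis gap : forall j l, j != l -> g <= `|nu j - nu l|.

Let weight (t : R) : R := cos (pi / T * (t - T / 2)).

Let cont_weight : continuous weight.
Proof. exact: continuous_cos_affine. Qed.

Let cont_sqr (c : R) (p q : J -> R) :
  continuous (fun t => trig_re c p q t ^+ 2 + trig_im c p q t ^+ 2).
Proof.
apply: continuous1D; apply: continuous1X.
  exact: continuous_trig_re.
exact: continuous_trig_im.
Qed.

(** The weight is even about T / 2: the sine terms of [trig_sqr_expand] integrate to 0 and each
    cosine term gives a value of the kernel. *)
Lemma Rintegral_weight (p q : J -> R) :
  \int[@lebesgue_measure R]_(t in `[0, T])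
    (weight t * (trig_re (T / 2) p q t ^+ 2 + trig_im (T / 2) p q t ^+ 2)) =
  \sum_j \sum_l (p j * p l + q j * q l) * trig_kernel T (nu j - nu l).
Proof.
have p0 : 0 < pi :> R := pi_gt0 R.
have a0 : 0 < pi / T by rewrite divr_gt0.
have ag : pi / T < g.
  by rewrite ltr_pdivrMr // (lt_trans _ gT) // ltr_pMl // ltr1n.
have nz j l : (pi / T + (nu j - nu l) != 0) /\ (pi / T - (nu j - nu l) != 0).
  have [->|/gap] := eqVneq j l; first by rewrite subrr addr0 subr0 gt_eqF.
  move=> h; have {}h := lt_le_trans ag h; split; apply/eqP => e.
    by move: h; rewrite (_ : nu j - nu l = - (pi / T)) ?normrN ?gtr0_norm ?ltxx; lra.
  by move: h; rewrite (_ : nu j - nu l = pi / T) ?gtr0_norm ?ltxx; lra.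
pose Fc (s t : R) : R := 2^-1 *
      ((pi / T + s)^-1 * sin ((pi / T + s) * (t - T / 2)) +
       (pi / T - s)^-1 * sin ((pi / T - s) * (t - T / 2))).
pose Fs (s t : R) : R := 2^-1 *
      ((pi / T - s)^-1 * cos ((pi / T - s) * (t - T / 2)) -
       (pi / T + s)^-1 * cos ((pi / T + s) * (t - T / 2))).
pose F (t : R) : R := \sum_j \sum_l ((p j * p l + q j * q l) * Fc (nu j - nu l) t +
                  (p j * q l - q j * p l) * Fs (nu j - nu l) t).
transitivity (F T - F 0).
  apply: Rintegral_FTC2 => //.
  - by apply: continuous1M; [exact: cont_weight|exact: cont_sqr].
  - move=> x; rewrite trig_sqr_expand mulr_sumr; apply: is_derive1_sum => j.
    rewrite mulr_sumr; apply: is_derive1_sum => l.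
    rewrite mulrDr !(mulrCA (weight x)).
    have [n1 n2] := nz j l.
    by apply: is_derive1D; apply: is_derive1Z;
      [exact: is_derive1_cos_cos|exact: is_derive1_cos_sin].
rewrite /F -sumrB; apply: eq_bigr => j _; rewrite -sumrB; apply: eq_bigr => l _.
rewrite /Fc /Fs /trig_kernel; have [n1 n2] := nz j l.
set s := nu j - nu l in n1 n2 *; clearbody s.
have -> : T - T / 2 = T / 2 by lra.
have : pi / T * (T / 2) = pi / 2 :> R by field; rewrite gt_eqF.
move: (pi / T) n1 n2 => a n1 n2 aT.
rewrite sub0r !mulrN !sinN !cosN !mulrDl !mulNr aT.
rewrite !sinD !cosD !sinN !cosN cos_pihalf sin_pihalf; lra.
Qed.

(** The weight is at most 1, so the plain integral dominates the weighted one, which is the Gram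
    form bounded by [trig_gram_ge]. *)
Theorem ingham_pair (c : R) (p q : J -> R) :
  ingham_const T g * (\sum_j (p j ^+ 2 + q j ^+ 2)) <=
  \int[@lebesgue_measure R]_(t in `[0, T])
    (trig_re c p q t ^+ 2 + trig_im c p q t ^+ 2).
Proof.
pose p' j : R := p j * cos (nu j * (T / 2 - c)) - q j * sin (nu j * (T / 2 - c)).
pose q' j : R := p j * sin (nu j * (T / 2 - c)) + q j * cos (nu j * (T / 2 - c)).
have rot t := trig_rotate c (T / 2) t p q.
have -> : \sum_j (p j ^+ 2 + q j ^+ 2) = \sum_j (p' j ^+ 2 + q' j ^+ 2).
  by have [_ _] := rot 0.
have -> : (fun t => trig_re c p q t ^+ 2 + trig_im c p q t ^+ 2) =
    (fun t => trig_re (T / 2) p' q' t ^+ 2 + trig_im (T / 2) p' q' t ^+ 2).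
  by apply/funext => t; have [-> -> _] := rot t.
clear rot; clearbody p' q'.
apply: (le_trans (trig_gram_ge T0 gT gap p' q')); rewrite -Rintegral_weight.
apply: le_Rintegral => //.
- apply: continuous_integrable_itv; apply: continuous_subspaceT.
  by apply: continuous1M; [exact: cont_weight|exact: cont_sqr].
- apply: continuous_integrable_itv; apply: continuous_subspaceT.
  exact: cont_sqr.
- by move=> x _; rewrite ler_piMl ?cos_le1 // addr_ge0 ?sqr_ge0.
Qed.

End FrequencyFamily.

(** A real signal is an exponential sum over the doubled family of frequencies with both signs, with
    conjugate coefficients (al - i be) / 2 and (al + i be) / 2, so that the imaginary part cancels.
    The condition on sums of frequencies separates the two copies; the factor 1/2 is the squared
    size of the two halves. *)
Theorem ingham (I : finType) (omega : I -> R) (T g c : R) (al be : I -> R) :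
    0 < T -> 2 * pi < g * T ->
    (forall i j, i != j -> g <= `|omega i - omega j|) ->
    (forall i j, g <= omega i + omega j) ->
  ingham_const T g * (2^-1 * \sum_i (al i ^+ 2 + be i ^+ 2)) <=
  \int[@lebesgue_measure R]_(t in `[0, T])
    (\sum_i (al i * cos (omega i * (t - c)) + be i * sin (omega i * (t - c)))) ^+ 2.
Proof.
move=> T0 gT gapB gapD.
pose nu (j : bool * I) : R := (-1) ^+ j.1 * omega j.2.
pose p (j : bool * I) : R := al j.2 / 2.
pose q (j : bool * I) : R := - ((-1) ^+ j.1 * be j.2 / 2).
have gap j l : j != l -> g <= `|nu j - nu l|.
  case: j l => [[] i] [[] j]; rewrite /nu xpair_eqE /= ?expr0 ?expr1 ?mul1r ?mulN1r.
  - by move=> /gapB; rewrite -opprD normrN.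
  - by move=> _; rewrite -opprD normrN (le_trans (gapD i j)) // ler_norm.
  - by move=> _; rewrite opprK (le_trans (gapD i j)) // ler_norm.
  - exact: gapB.
have sumJ (F : bool * I -> R) : \sum_j F j = \sum_i (F (true, i) + F (false, i)).
  rewrite big_split /= (eq_bigr (fun j => F (j.1, j.2))); last by case.
  by rewrite -(pair_big predT predT (fun b i => F (b, i))) /= big_bool.
have := @ingham_pair _ nu T g T0 gT gap c p q; rewrite sumJ.
rewrite (_ : \sum_i _ = 2^-1 * \sum_i (al i ^+ 2 + be i ^+ 2)); last first.
  by rewrite mulr_sumr; apply: eq_bigr => i _; rewrite /p /q /=; field.
move=> /le_trans; apply; rewrite le_eqVlt; apply/orP; left; apply/eqP.
apply: eq_Rintegral => t _; rewrite /trig_re /trig_im !sumJ.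
rewrite [X in _ + X ^+ 2]big1 ?expr0n ?addr0.
  congr (_ ^+ 2); apply: eq_bigr => i _.
  by rewrite /p /q /nu /= expr1 expr0 !mulN1r !mul1r !mulNr cosN sinN; field.
by move=> i _; rewrite /p /q /nu /= expr1 expr0 !mulN1r !mul1r !mulNr cosN sinN; field.
Qed.

End Ingham.

(** * Dispersion relation and group velocity *)

Section DerivOn.
Variable R : realType.
Implicit Types (f g : R -> R) (a b x l : R).

(** Properness of the filter is what identifies the [lim] inside [deriv_on] with a limit computed by
    other means. Nearby points are taken to the right of x, or to the left when x is b. *)
Lemma dnbhs_within_itv_proper a b x : a < b -> a <= x <= b ->
  ProperFilter (within `[a, b] x^').
Proof.
move=> ab /andP[ax xb]; apply: Build_ProperFilter_ex => B.
move=> [e /= e0 He].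
have [xb'|bx] := ltP x b.
  pose d := Num.min (e / 2) (b - x).
  have d0 : 0 < d by rewrite /d lt_min divr_gt0 //= subr_gt0.
  have de : d <= e / 2 by rewrite /d ge_min lexx.
  have db : d <= b - x by rewrite /d ge_min lexx orbT.
  exists (x + d); apply: He => /=.
  - by rewrite opprD addrA subrr sub0r normrN gtr0_norm //; lra.
  - by rewrite gt_eqF // ltrDl.
  - by rewrite in_itv /=; lra.
pose d := Num.min (e / 2) (x - a).
have d0 : 0 < d by rewrite /d lt_min divr_gt0 //= subr_gt0 (lt_le_trans ab).
have de : d <= e / 2 by rewrite /d ge_min lexx.
have db : d <= x - a by rewrite /d ge_min lexx orbT.
exists (x - d); apply: He => /=.
- by rewrite opprD addrA subrr sub0r opprK gtr0_norm //; lra.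
- by rewrite lt_eqF // ltrBlDr ltrDl.
- by rewrite in_itv /=; lra.
Qed.

Lemma is_derive_is_deriv_on (A : set R) f g x l :
    A x -> {in A, f =1 g} -> is_derive x 1 g l ->
  is_deriv_on A f x l.
Proof.
move=> Ax fg /is_derive1_caratheodory[q [qE cq <-]].
have : q @ within A x^' --> q x.
  apply: cvg_within_filter; apply: cvg_within_filter; exact: cq.
apply: cvg_trans; apply: near_eq_cvg.
rewrite near_withinE; near=> y => Ay.
rewrite fg ?inE // fg ?inE // qE mulfK // subr_eq0.
by near: y; exact: nbhs_dnbhs_neq.
Unshelve. all: by end_near. Qed.

(** The function f has to match a smooth g on the interval only. This gives the one-sided derivative
    of [lambda_a] at 0, where it behaves like the absolute value of a sine. *)
Lemma deriv_on_val a b f g x l :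
    a < b -> a <= x <= b -> {in `[a, b], f =1 g} -> is_derive x 1 g l ->
  deriv_on `[a, b] f x = l.
Proof.
move=> ab xab fg dg; have FF := dnbhs_within_itv_proper ab xab.
apply: cvg_lim => //; apply: is_derive_is_deriv_on dg; first by rewrite /= in_itv.
by move=> y; rewrite inE => /fg.
Qed.

Lemma is_deriv_on_is_derive a b f x l :
  x \in `]a, b[ -> is_deriv_on `[a, b] f x l -> is_derive x 1 f l.
Proof.
rewrite in_itv /= => /andP[ax xb] df.
apply/is_derive1_caratheodory.
exists (fun z => if z == x then l else (f z - f x) / (z - x)); split.
- move=> z; have [->|zx] := eqVneq z x; first by rewrite !subrr mulr0.
  by rewrite divfK // subr_eq0.
- apply/continuous_withinNx; rewrite eqxx.
  have : (f y - f x) / (y - x) @[y --> x^'] --> l.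
    apply: cvg_trans df; apply: cvg_app => B [e /= e0 He].
    pose d := Num.min e (Num.min (x - a) (b - x)).
    have d0 : 0 < d by rewrite !lt_min e0 !subr_gt0 ax xb.
    exists d => //= y yd yx; apply: He => //=.
      by rewrite (lt_le_trans yd) // ge_min lexx.
    have h1 : `|x - y| < x - a by rewrite (lt_le_trans yd) // !ge_min lexx !orbT.
    have h2 : `|x - y| < b - x by rewrite (lt_le_trans yd) // !ge_min lexx !orbT.
    by move: h1 h2; rewrite !ltr_norml in_itv /=; lra.
  apply: cvg_trans; apply: near_eq_cvg; near=> y.
  by rewrite ifN //; near: y; exact: nbhs_dnbhs_neq.
- by rewrite eqxx.
Unshelve. all: by end_near. Qed.

Lemma is_deriv_on_continuous a b f x l :
  is_deriv_on `[a, b] f x l -> f @ within `[a, b] (nbhs x) --> f x.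
Proof.
move=> /cvgrPdist_lt /(_ 1 ltr01) [e /= e0 He].
apply/cvgrPdist_lt => eps eps0.
have L0 : 0 < `|l| + 1 by rewrite ltr_wpDl.
exists (Num.min e (eps / (`|l| + 1))) => /=; first by rewrite lt_min e0 divr_gt0.
move=> y /=; rewrite lt_min => /andP[ye yeps] yab.
have [->|yx] := eqVneq y x; first by rewrite subrr normr0.
have {}He := He y ye yx yab; have yx0 : y - x != 0 by rewrite subr_eq0.
have -> : f x - f y = - ((f y - f x) / (y - x)) * (y - x) by field.
set q := (f y - f x) / (y - x) in He *.
rewrite normrM normrN distrC -ltr_pdivlMr ?normr_gt0 1?subr_eq0 1?eq_sym //.
have qL : `|q| < `|l| + 1.
  by rewrite -(subrK l q) (le_lt_trans (ler_normD _ _)) // addrC ltrD2l distrC.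
rewrite (lt_trans qL) // ltr_pdivlMr ?normr_gt0 1?subr_eq0 1?eq_sym //.
by rewrite mulrC -ltr_pdivlMr.
Qed.

Lemma zero_deriv_on_cst (T : R) f : 0 < T ->
    (forall t, t \in `]0, T[ -> is_derive t 1 f 0) ->
    {within `[0, T], continuous f} ->
  forall t, t \in `[0, T] -> f t = f T.
Proof.
move=> T0 df cf t /andP[]; rewrite !bnd_simp => t0 tT.
have d x : x \in `]t, T[ -> is_derive x 1 f ((fun=> 0) x).
  rewrite in_itv /= => /andP[tx xT]; apply: df.
  by rewrite in_itv /= xT (le_lt_trans t0 tx).
have c : {within `[t, T], continuous f}.
  apply: continuous_subspaceW cf => x /=; rewrite !in_itv /= => /andP[tx ->].
  by rewrite (le_trans t0 tx).
have [x _ /eqP] := MVT_segment tT d c.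
by rewrite mul0r subr_eq0 => /eqP.
Qed.

End DerivOn.

(** * The two branches of the dispersion relation and their distance *)

Section Spectrum.
Variable R : realType.
Implicit Types C eta : R.

(* Both branches are functions of [C = cos (eta / 2) ^+ 2]. *)
Definition disc C : R := 1 + 268 * C - 44 * C ^+ 2.
Definition acou C : R := 120 * (1 - C) / (11 + 4 * C + Num.sqrt (disc C)).
Definition opti C : R := (22 + 8 * C + 2 * Num.sqrt (disc C)) / (2 - C).

Lemma disc_ge1 C : 0 <= C <= 1 -> 1 <= disc C.
Proof. by move=> /andP[C0 C1]; rewrite /disc; nra. Qed.

Lemma disc_homo C C' : 0 <= C -> C <= C' -> C' <= 1 -> disc C <= disc C'.
Proof.
move=> C0 CC C1; rewrite -subr_ge0.
rewrite (_ : disc C' - disc C = (C' - C) * (268 - 44 * (C + C'))); last first.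
  by rewrite /disc; ring.
by rewrite mulr_ge0 //; lra.
Qed.

Lemma sqrt_disc_ge1 C : 0 <= C <= 1 -> 1 <= Num.sqrt (disc C).
Proof. by move=> h; rewrite -(sqrtr1 R) ler_wsqrtr // disc_ge1. Qed.

Lemma sqr_sqrt_disc C : 0 <= C <= 1 -> Num.sqrt (disc C) ^+ 2 = disc C.
Proof. by move=> h; rewrite sqr_sqrtr // (le_trans ler01) // disc_ge1. Qed.

Lemma disc_1 : Num.sqrt (disc 1) = 15.
Proof.
rewrite (_ : disc 1 = 15 ^+ 2); first by rewrite sqrtr_sqr ger0_norm.
by rewrite /disc; ring.
Qed.

Lemma disc_0 : Num.sqrt (disc 0) = 1.
Proof.
by rewrite (_ : disc 0 = 1) ?sqrtr1 // /disc; ring.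
Qed.

Lemma sqrt_disc_le15 C : 0 <= C <= 1 -> Num.sqrt (disc C) <= 15.
Proof.
by move=> /andP[C0 C1]; rewrite -disc_1 ler_wsqrtr // disc_homo.
Qed.

Lemma acou_anti C C' : 0 <= C -> C <= C' -> C' <= 1 -> acou C' <= acou C.
Proof.
move=> C0 CC C1; rewrite /acou.
have h1 : 1 <= Num.sqrt (disc C) by apply: sqrt_disc_ge1; lra.
have h2 : Num.sqrt (disc C) <= Num.sqrt (disc C') by rewrite ler_wsqrtr ?disc_homo.
move: (Num.sqrt (disc C)) (Num.sqrt (disc C')) h1 h2 => D D' h1 h2.
apply: ler_pM; rewrite ?invr_ge0; try lra.
by rewrite lef_pV2 ?posrE; lra.
Qed.

Lemma opti_homo C C' : 0 <= C -> C <= C' -> C' <= 1 -> opti C <= opti C'.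
Proof.
move=> C0 CC C1; rewrite /opti.
have h1 : 1 <= Num.sqrt (disc C) by apply: sqrt_disc_ge1; lra.
have h2 : Num.sqrt (disc C) <= Num.sqrt (disc C') by rewrite ler_wsqrtr ?disc_homo.
move: (Num.sqrt (disc C)) (Num.sqrt (disc C')) h1 h2 => D D' h1 h2.
apply: ler_pM; rewrite ?invr_ge0; try lra.
by rewrite lef_pV2 ?posrE; lra.
Qed.

Lemma opti_lt C C' : 0 <= C -> C < C' -> C' <= 1 -> opti C < opti C'.
Proof.
move=> C0 CC C1; rewrite /opti.
have h1 : 1 <= Num.sqrt (disc C) by apply: sqrt_disc_ge1; lra.
have h2 : Num.sqrt (disc C) <= Num.sqrt (disc C') by apply/ler_wsqrtr/disc_homo => //; exact: ltW.
move: (Num.sqrt (disc C)) (Num.sqrt (disc C')) h1 h2 => D D' h1 h2.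
apply: ltr_pM; rewrite ?invr_ge0; try lra.
by rewrite ltf_pV2 ?posrE; lra.
Qed.

Lemma acou_0 : acou 0 = 10.
Proof. by rewrite /acou disc_0; field. Qed.

Lemma acou_1 : acou 1 = 0.
Proof. by rewrite /acou subrr mulr0 mul0r. Qed.

Lemma opti_0 : opti 0 = 12.
Proof. by rewrite /opti disc_0; field. Qed.

Lemma opti_1 : opti 1 = 60.
Proof. by rewrite /opti disc_1; field. Qed.

Lemma acou_ge0 C : 0 <= C <= 1 -> 0 <= acou C.
Proof. by move=> /andP[C0 C1]; rewrite -acou_1 acou_anti. Qed.

Lemma opti_ge12 C : 0 <= C <= 1 -> 12 <= opti C.
Proof. by move=> /andP[C0 C1]; rewrite -opti_0 opti_homo. Qed.

Lemma opti_le60 C : 0 <= C <= 1 -> opti C <= 60.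
Proof. by move=> /andP[C0 C1]; rewrite -opti_1 opti_homo. Qed.

(** Rationalisation, from (11 + 4 C)^2 - disc C = 60 (1 - C) (2 - C). In this form [acou] and [opti]
    are visibly the two roots of one quadratic, while the defining form makes monotonicity a matter
    of numerator and denominator. *)
Lemma acou_alt C : 0 <= C <= 1 ->
  acou C = (22 + 8 * C - 2 * Num.sqrt (disc C)) / (2 - C).
Proof.
move=> h; have := sqr_sqrt_disc h; have h1 := sqrt_disc_ge1 h.
rewrite /acou {2}/disc; case/andP: h => C0 C1.
move: (Num.sqrt _) h1 => D h1 D2.
apply/eqP; rewrite eqr_div; [|lra..].
by apply/eqP; rewrite -[LHS]subr0; nra.
Qed.

(* The condition for the sine modes to satisfy the eigenvalue equation at the
   vertices, once the midpoint values have been eliminated. *)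
Definition dispersion C L : Prop :=
  (2 - C) * L ^+ 2 - (44 + 16 * C) * L + 240 * (1 - C) = 0.

Lemma acou_dispersion C : 0 <= C <= 1 -> dispersion C (acou C).
Proof.
move=> h; rewrite /dispersion acou_alt //.
have := sqr_sqrt_disc h; rewrite {2}/disc; case/andP: h => C0 C1.
move: (Num.sqrt _) => D D2; have n : 2 - C != 0 by rewrite gt_eqF //; lra.
apply: (mulfI n); rewrite mulr0.
transitivity (4 * (D ^+ 2 - (1 + 268 * C - 44 * C ^+ 2))); first by field.
by rewrite D2 subrr mulr0.
Qed.

Lemma opti_dispersion C : 0 <= C <= 1 -> dispersion C (opti C).
Proof.
move=> h; rewrite /dispersion /opti.
have := sqr_sqrt_disc h; rewrite {2}/disc; case/andP: h => C0 C1.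
move: (Num.sqrt _) => D D2; have n : 2 - C != 0 by rewrite gt_eqF //; lra.
apply: (mulfI n); rewrite mulr0.
transitivity (4 * (D ^+ 2 - (1 + 268 * C - 44 * C ^+ 2))); first by field.
by rewrite D2 subrr mulr0.
Qed.

(* From the sum and the product of the roots:
   [(2 - C) (u - v) ^+ 2 = 44 + 16 C - 2 sqrt (240 (1 - C) (2 - C))]. *)
Lemma opti_acou_gap C : 0 <= C <= 1 ->
  4 * Num.sqrt C <= Num.sqrt (opti C) - Num.sqrt (acou C).
Proof.
move=> h; have [C0 C1] := andP h.
have a0 := acou_ge0 h; have o0 := opti_ge12 h.
set u := Num.sqrt (opti C); set v := Num.sqrt (acou C).
have u0 : 0 <= u := sqrtr_ge0 _; have v0 : 0 <= v := sqrtr_ge0 _.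
have uE : u ^+ 2 = opti C by rewrite sqr_sqrtr //; lra.
have vE : v ^+ 2 = acou C by rewrite sqr_sqrtr.
have c0 : 0 < 2 - C by lra.
have sum : (2 - C) * (u ^+ 2 + v ^+ 2) = 44 + 16 * C.
  by rewrite uE vE acou_alt // /opti; field; rewrite gt_eqF.
have prod : (2 - C) * (u ^+ 2 * v ^+ 2) = 240 * (1 - C).
  have := opti_dispersion h; rewrite /dispersion -uE => d.
  have e : v ^+ 2 * (2 - C) = 44 + 16 * C - (2 - C) * u ^+ 2 by rewrite -sum; ring.
  rewrite mulrCA [X in u ^+ 2 * X]mulrC e; move: d.
  by move: (u ^+ 2) => U d; lra.
have vu : v <= u.
  rewrite -(@ler_pXn2r _ 2) ?nnegrE // uE vE.
  by apply: (@le_trans _ _ 10); rewrite ?(le_trans _ o0) ?ler_nat // -acou_0 acou_anti.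
(* The right-hand side is the one for which 44 + 16 C minus twice it equals 16 C (2 - C), that is (2
   - C) times the square of 4 sqrt C. The bound itself is proved by comparing squares, using the
   product of the roots. *)
have uv : (2 - C) * (u * v) <= 22 - 8 * C + 8 * C ^+ 2.
  have l0 : 0 <= (2 - C) * (u * v) by rewrite mulr_ge0 ?(ltW c0) ?mulr_ge0.
  have r0 : 0 <= 22 - 8 * C + 8 * C ^+ 2 by nra.
  rewrite -(@ler_pXn2r _ 2) ?nnegrE // !exprMn expr2 -mulrA prod.
  have -> : (22 - 8 * C + 8 * C ^+ 2) ^+ 2 = (2 - C) * (240 * (1 - C)) +
    (4 + 368 * C + 48 * C ^+ 2 + 128 * (C ^+ 2 * (1 - C)) + 64 * (C ^+ 2) ^+ 2)
    by ring.
  have q0 : 0 <= C ^+ 2 := sqr_ge0 _.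
  have q1 : 0 <= C ^+ 2 * (1 - C) by rewrite mulr_ge0 ?subr_ge0.
  have q2 : 0 <= (C ^+ 2) ^+ 2 := sqr_ge0 _.
  by rewrite lerDl; lra.
have s0 : 0 <= Num.sqrt C := sqrtr_ge0 _.
have s4 : 0 <= 4 * Num.sqrt C by rewrite mulr_ge0.
rewrite -(@ler_pXn2r _ 2) ?nnegrE ?subr_ge0 //.
rewrite exprMn sqr_sqrtr // -(ler_pM2l c0) sqrrB.
have -> : (2 - C) * (u ^+ 2 - u * v *+ 2 + v ^+ 2) =
  44 + 16 * C - 2 * ((2 - C) * (u * v)) by rewrite -sum; ring.
lra.
Qed.

Lemma cos2_itv eta : 0 <= cos (eta / 2) ^+ 2 <= 1.
Proof.
by rewrite sqr_ge0 /= cos2sin2 gerBl sqr_ge0.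
Qed.

Lemma Lambda_aE eta : Lambda_a eta = acou (cos (eta / 2) ^+ 2).
Proof.
rewrite /Lambda_a /acou sin2cos2 /Delta /disc.
by rewrite (_ : cos (eta / 2) ^+ 4 = (cos (eta / 2) ^+ 2) ^+ 2) // -exprM.
Qed.

Lemma Lambda_oE eta : Lambda_o eta = opti (cos (eta / 2) ^+ 2).
Proof.
rewrite /Lambda_o /opti sin2cos2 /Delta /disc.
rewrite (_ : cos (eta / 2) ^+ 4 = (cos (eta / 2) ^+ 2) ^+ 2) -?exprM //.
by congr (_ / _); ring.
Qed.

End Spectrum.

(** * Derivatives of the two frequency functions *)

Section GroupVelocity.
Variable R : realType.
Implicit Types eta x y : R.

Lemma is_derive1_cos2_half eta : is_derive eta 1
  (fun t : R => cos (t / 2) ^+ 2) (- (cos (eta / 2) * sin (eta / 2))).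
Proof.
have E t : t / 2 = 2^-1 * (t - 0) :> R by rewrite subr0 mulrC.
rewrite (_ : (fun _ => _) =
    (fun t => cos (2^-1 * (t - 0)) * cos (2^-1 * (t - 0)))); last first.
  by apply/funext => t; rewrite E expr2.
rewrite !E (_ : - _ =
    cos (2^-1 * (eta - 0)) * - (2^-1 * sin (2^-1 * (eta - 0))) +
    cos (2^-1 * (eta - 0)) * - (2^-1 * sin (2^-1 * (eta - 0)))); last by field.
by apply: is_derive1M; exact: is_derive1_cos_affine.
Qed.

Lemma is_derive1_sqrt_comp (f : R -> R) x a : 0 < f x -> is_derive x 1 f a ->
  is_derive x 1 (fun t => Num.sqrt (f t)) ((2 * Num.sqrt (f x))^-1 * a).
Proof.
by move=> fx df; apply: (is_derive1_comp (f := Num.sqrt)); exact: is_derive1_sqrt.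
Qed.

Lemma is_derive1_inv (f : R -> R) x a : f x != 0 -> is_derive x 1 f a ->
  is_derive x 1 (fun t => (f t)^-1) (- f x ^- 2 * a).
Proof. by move=> fx df; exact: is_deriveV. Qed.

Let Cf eta : R := cos (eta / 2) ^+ 2.
Let dCf eta : R := - (cos (eta / 2) * sin (eta / 2)).
Let Df eta : R := Num.sqrt (disc (Cf eta)).
Let dDf eta : R := (2 * Df eta)^-1 * ((268 - 88 * Cf eta) * dCf eta).

Let is_derive_Cf eta : is_derive eta 1 Cf (dCf eta).
Proof. exact: is_derive1_cos2_half. Qed.

Let Df_ge1 eta : 1 <= Df eta.
Proof. exact: sqrt_disc_ge1 (cos2_itv _). Qed.

Let is_derive_Df eta : is_derive eta 1 Df (dDf eta).
Proof.
have h := is_derive_Cf eta.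
apply: is_derive1_sqrt_comp.
  by rewrite (lt_le_trans ltr01) // disc_ge1 // cos2_itv.
rewrite (_ : (fun t => disc (Cf t)) =
  (fun t => (cst 1 t + 268 * Cf t) - 44 * (Cf t * Cf t))); last first.
  by apply/funext => t; rewrite /disc expr2.
rewrite (_ : _ * dCf eta = (0 + 268 * dCf eta) -
   44 * (Cf eta * dCf eta + Cf eta * dCf eta)); last by ring.
exact: is_derive1B.
Qed.

Definition acou_den eta : R := 11 + 4 * Cf eta + Df eta.

(* Unlike [lambda_a], this is smooth at [0]. *)
Definition lambda_a_smooth eta : R :=
  sin (eta / 2) * Num.sqrt (120 * (acou_den eta)^-1).

(** Left in the shape produced by the product and chain rules, trivial summands included, so that
    the derivative lemmas apply without rewriting. *)
Definition dlambda_a eta : R :=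
  sin (eta / 2) * ((2 * Num.sqrt (120 * (acou_den eta)^-1))^-1 *
    (120 * (- acou_den eta ^- 2 * (0 + 4 * dCf eta + dDf eta)))) +
  Num.sqrt (120 * (acou_den eta)^-1) * (2^-1 * cos (2^-1 * (eta - 0))).

Definition opti_fun eta : R :=
  (22 + 8 * Cf eta + 2 * Df eta) * (2 - Cf eta)^-1.

Definition dlambda_o eta : R :=
  (2 * Num.sqrt (opti_fun eta))^-1 *
  ((22 + 8 * Cf eta + 2 * Df eta) * (- (2 - Cf eta) ^- 2 * (0 - dCf eta)) +
   (2 - Cf eta)^-1 * (0 + 8 * dCf eta + 2 * dDf eta)).

Let Cf_itv eta : 0 <= Cf eta <= 1. Proof. exact: cos2_itv. Qed.

Lemma acou_den_itv eta : 12 <= acou_den eta <= 30.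
Proof.
have /andP[c0 c1] := Cf_itv eta; have d1 := Df_ge1 eta.
have d2 := sqrt_disc_le15 (Cf_itv eta); rewrite -/(Df eta) in d2.
by rewrite /acou_den; lra.
Qed.

Lemma is_derive_lambda_a_smooth eta :
  is_derive eta 1 lambda_a_smooth (dlambda_a eta).
Proof.
have /andP[w1 w2] := acou_den_itv eta.
have w0 : 0 < acou_den eta by lra.
apply: is_derive1M; last first.
  apply: is_derive1_sqrt_comp; first by rewrite mulr_gt0 ?invr_gt0.
  apply: is_derive1Z; apply: is_derive1_inv; first by rewrite gt_eqF.
  apply: (is_derive1D (f := fun t => cst 11 t + 4 * Cf t)).
    by apply: is_derive1D; apply: is_derive1Z.
  exact: is_derive_Df.
rewrite (_ : (fun _ => _) = (fun y => sin (2^-1 * (y - 0)))).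
  exact: is_derive1_sin_affine.
by apply/funext => t; rewrite subr0 mulrC.
Qed.

Lemma is_derive_sqrt_opti eta :
  is_derive eta 1 (fun t => Num.sqrt (opti_fun t)) (dlambda_o eta).
Proof.
have /andP[c0 c1] := Cf_itv eta; have d1 := Df_ge1 eta.
have n0 : 0 < 22 + 8 * Cf eta + 2 * Df eta by lra.
have m0 : 0 < 2 - Cf eta by lra.
apply: is_derive1_sqrt_comp; first by rewrite mulr_gt0 ?invr_gt0.
apply: is_derive1M; last first.
  apply: is_derive1_inv; first by rewrite gt_eqF.
  exact: (is_derive1B (f := cst 2)).
apply: (is_derive1D (f := fun t => cst 22 t + 8 * Cf t)).
  by apply: is_derive1D; apply: is_derive1Z.
by apply: is_derive1Z; exact: is_derive_Df.
Qed.

Lemma half_itv eta : 0 <= eta <= pi ->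
  0 <= sin (eta / 2) /\ 0 <= cos (eta / 2).
Proof.
move=> /andP[e0 e1]; split; first by apply: sin_ge0_pi; lra.
by apply: cos_ge0_pihalf; lra.
Qed.

Lemma lambda_aE eta : 0 <= eta <= pi -> lambda_a eta = lambda_a_smooth eta.
Proof.
move=> /half_itv[s0 c0]; rewrite /lambda_a /lambda_a_smooth.
rewrite -[X in _ = X * _](ger0_norm s0) -sqrtr_sqr -sqrtrM ?sqr_ge0 //.
congr Num.sqrt; rewrite Lambda_aE /acou /acou_den -sin2cos2.
by rewrite [RHS]mulrA [_ * 120]mulrC.
Qed.

Lemma lambda_oE eta : lambda_o eta = Num.sqrt (opti_fun eta).
Proof. by rewrite /lambda_o Lambda_oE. Qed.

(** [acou_den] decreases with eta, so differentiating the square root contributes a nonnegative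
    term. Differentiating the sine contributes half the cosine times a square root that is at least
    2, because [acou_den] is at most 30. *)
Lemma dlambda_a_ge eta : 0 <= eta <= pi -> cos (eta / 2) <= dlambda_a eta.
Proof.
move=> h; have [s0 c0] := half_itv h.
have /andP[w1 w2] := acou_den_itv eta.
have /andP[C0 C1] := Cf_itv eta; have d1 := Df_ge1 eta.
have G2 : 2 <= Num.sqrt (120 * (acou_den eta)^-1).
  rewrite -[leLHS](@ger0_norm _ 2) // -sqrtr_sqr ler_wsqrtr //.
  by rewrite ler_pdivlMr; lra.
rewrite /dlambda_a subr0 (mulrC 2^-1 eta).
set G := Num.sqrt _ in G2 *; rewrite -[leLHS]add0r; apply: lerD; last by nra.
have x0 : 4 * dCf eta + dDf eta <= 0.
  have dC : dCf eta <= 0 by rewrite oppr_le0 mulr_ge0.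
  have dD : dDf eta <= 0.
    rewrite /dDf mulr_ge0_le0 ?invr_ge0; [by []|lra|].
    by rewrite mulr_ge0_le0 //; lra.
  lra.
rewrite mulr_ge0 // mulr_ge0 ?invr_ge0 //; first by lra.
rewrite mulr_ge0 // mulr_le0 ?add0r // oppr_le0 invr_ge0 exprn_ge0 //; lra.
Qed.

Lemma dlambda_a_0 : dlambda_a 0 = 1.
Proof.
rewrite /dlambda_a mul0r sin0 mul0r add0r subr0 mulr0 cos0 mulr1.
rewrite /acou_den /Df /Cf mul0r cos0 expr1n disc_1.
rewrite (_ : 120 * _ = 2 ^+ 2); last by field.
by rewrite sqrtr_sqr ger0_norm // divff.
Qed.

Let dlambda_o_alg (C D z : R) : 0 <= C <= 1 -> 1 <= D -> 0 <= z ->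
  4 * z <= - ((22 + 8 * C + 2 * D) * (- (2 - C) ^- 2 * (0 - - z)) +
    (2 - C)^-1 * (0 + 8 * - z + 2 * ((2 * D)^-1 * ((268 - 88 * C) * - z)))).
Proof.
move=> /andP[C0 C1] d1 z0.
have -> : - ((22 + 8 * C + 2 * D) * (- (2 - C) ^- 2 * (0 - - z)) +
    (2 - C)^-1 * (0 + 8 * - z + 2 * ((2 * D)^-1 * ((268 - 88 * C) * - z)))) =
  z * ((22 + 8 * C + 2 * D) / (2 - C) ^+ 2 +
    (2 - C)^-1 * (8 + (268 - 88 * C) / D)).
  by field; rewrite !gt_eqF //; lra.
rewrite mulrC ler_wpM2l // -[leLHS]addr0 lerD //.
  rewrite ler_pdivlMr; last by rewrite exprn_gt0; lra.
  nra.
rewrite mulr_ge0 ?invr_ge0 //; first by lra.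
rewrite addr_ge0 // divr_ge0 //; lra.
Qed.

(** Minus the derivative of [opti_fun] is at least 4 cos sin (of eta / 2), and the square root in
    the chain rule is at most 8 because [opti_fun] is at most 60: the quotient is 4 / 16. *)
Lemma dlambda_o_le eta : 0 <= eta <= pi ->
  cos (eta / 2) * sin (eta / 2) / 4 <= - dlambda_o eta.
Proof.
move=> h; have [s0 c0] := half_itv h.
have O1 : 12 <= opti_fun eta := opti_ge12 (Cf_itv eta).
have O2 : opti_fun eta <= 60 := opti_le60 (Cf_itv eta).
have r8 : Num.sqrt (opti_fun eta) <= 8.
  rewrite -[leRHS](@ger0_norm _ 8) // -sqrtr_sqr ler_wsqrtr //; lra.
have r0 : 0 < Num.sqrt (opti_fun eta) by rewrite sqrtr_gt0; lra.
have z0 := mulr_ge0 c0 s0.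
have alg := dlambda_o_alg (Cf_itv eta) (Df_ge1 eta) z0.
have q : 16^-1 <= (2 * Num.sqrt (opti_fun eta))^-1 by rewrite lef_pV2 ?posrE; lra.
rewrite /dlambda_o -mulrN (_ : _ / 4 = 16^-1 * (4 * (cos (eta / 2) * sin (eta / 2)))).
  by apply: ler_pM => //; lra.
by field.
Qed.

Lemma deriv_on_lambda_a eta : 0 <= eta <= pi ->
  deriv_on `[0, pi] (@lambda_a R) eta = dlambda_a eta.
Proof.
move=> h; apply: (deriv_on_val (g := lambda_a_smooth)) => //.
- exact: pi_gt0.
- by move=> x; rewrite in_itv /=; exact: lambda_aE.
- exact: is_derive_lambda_a_smooth.
Qed.

Lemma deriv_on_lambda_o eta : 0 <= eta <= pi ->
  deriv_on `[0, pi] (@lambda_o R) eta = dlambda_o eta.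
Proof.
move=> h; apply: (deriv_on_val (g := fun t => Num.sqrt (opti_fun t))) => //.
- exact: pi_gt0.
- by move=> x _; exact: lambda_oE.
- exact: is_derive_sqrt_opti.
Qed.

End GroupVelocity.

(** * Branch separation and uniform bounds on the truncated spectrum *)

Section GroupVelocityBounds.
Variable R : realType.
Implicit Types eta x y : R.

Lemma mean_value_ge (f df : R -> R) (k x y : R) :
    (forall t : R, is_derive t 1 f (df t)) ->
    (forall t, x <= t <= y -> k <= df t) ->
  x <= y -> k * (y - x) <= f y - f x.
Proof.
move=> dfE kdf xy.
have c : {within `[x, y], continuous f}.
  by apply: continuous_subspaceT; exact: is_derive1_continuous dfE.
have [t] := MVT_segment xy (fun t _ => dfE t) c.
rewrite in_itv /= => txy ->.
by rewrite ler_wpM2r ?subr_ge0 ?kdf.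
Qed.

Lemma cos_half_mono x y : 0 <= x -> x <= y -> y <= pi ->
  cos (y / 2) <= cos (x / 2).
Proof.
move=> x0 xy yp; have p0 := pi_gt0 R.
rewrite leNgt ltr_cos ?in_itv /=; [by rewrite -leNgt; lra|lra|lra].
Qed.

(** On this range cos (2 t) >= 0 forces cos t >= 1/2, and the mean value theorem concludes. Taken at
    half the mesh step in wave number, this crude bound exactly absorbs the factor 4 of
    [opti_acou_gap]. *)
Lemma sin_ge_half y : 0 <= y <= pi / 4 -> y / 2 <= sin y.
Proof.
move=> /andP[y0 y1]; have p0 := pi_gt0 R.
have c : {within `[0, y], continuous (@sin R)}.
  by apply: continuous_subspaceT; exact: continuous_sin.
have [t] := MVT_segment y0 (fun t _ => is_derive_sin t) c.
rewrite sin0 !subr0 in_itv /= => /andP[t0 ty] ->.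
rewrite mulrC ler_wpM2r //.
have c0 : 0 <= cos t by apply: cos_ge0_pihalf; lra.
have : 0 <= cos (2 * t) by apply: cos_ge0_pihalf; lra.
rewrite mulr_natl cos_mulr2n; move: (cos t) c0 => c1 c0 h.
by rewrite leNgt; apply/negP => lt; nra.
Qed.

(** The optic frequency decreases and the acoustic one increases with the wave number, so even for
    different wave numbers the worst case is both at pi - x. There the squared cosine is sin (x /
    2)^2 and [opti_acou_gap] gives 4 sin (x / 2). *)
Lemma lambda_branch_gap x eta zeta : 0 <= x <= pi / 2 ->
    0 <= eta <= pi - x -> 0 <= zeta <= pi - x ->
  x <= lambda_o eta - lambda_a zeta.
Proof.
move=> /andP[x0 x1] /andP[e0 e1] /andP[z0 z1]; have p0 := pi_gt0 R.
have S : 0 <= sin (x / 2) by apply: sin_ge0_pi; lra.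
have C0 y : 0 <= y -> y <= pi - x -> sin (x / 2) ^+ 2 <= cos (y / 2) ^+ 2.
  move=> y0 y1; have h : sin (x / 2) <= cos (y / 2).
    rewrite -cosBpihalf -cosN (_ : - _ = (pi - x) / 2); last by field.
    by apply: cos_half_mono => //; lra.
  by apply: lerXn2r; rewrite ?nnegrE //; exact: le_trans h.
have Sitv : 0 <= sin (x / 2) ^+ 2 <= 1.
  by rewrite sqr_ge0 sin2cos2 gerBl sqr_ge0.
have [/andP[_ ce1] /andP[_ cz1]] := (cos2_itv eta, cos2_itv zeta).
have ho : Num.sqrt (opti (sin (x / 2) ^+ 2)) <= lambda_o eta.
  by rewrite /lambda_o Lambda_oE ler_wsqrtr // opti_homo ?sqr_ge0 ?C0.
have ha : lambda_a zeta <= Num.sqrt (acou (sin (x / 2) ^+ 2)).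
  by rewrite /lambda_a Lambda_aE ler_wsqrtr // acou_anti ?sqr_ge0 ?C0.
have := opti_acou_gap Sitv; rewrite sqrtr_sqr ger0_norm // => g.
have := @sin_ge_half (x / 2); lra.
Qed.

Lemma continuous_Lambda_a : {within `[0, pi], continuous (@Lambda_a R)}.
Proof.
have -> : @Lambda_a R = (fun t => lambda_a_smooth t ^+ 2).
  apply/funext => t; rewrite Lambda_aE /acou /lambda_a_smooth exprMn sqr_sqrtr.
    by rewrite sin2cos2 [RHS]mulrA [_ * 120]mulrC.
  have /andP[w1 _] := acou_den_itv t.
  by rewrite mulr_ge0 // invr_ge0; lra.
apply: continuous_subspaceT; apply: continuous1X.
apply: (@is_derive1_continuous _ _ (@dlambda_a R)) => t.
exact: is_derive_lambda_a_smooth.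
Qed.

Lemma continuous_Lambda_o : {within `[0, pi], continuous (@Lambda_o R)}.
Proof.
have -> : @Lambda_o R = (fun t => Num.sqrt (opti_fun t) ^+ 2).
  apply/funext => t; rewrite Lambda_oE sqr_sqrtr //.
  exact: le_trans (opti_ge12 (cos2_itv t)).
apply: continuous_subspaceT; apply: continuous1X.
apply: (@is_derive1_continuous _ _ (@dlambda_o R)) => t.
exact: is_derive_sqrt_opti.
Qed.

Lemma Lambda_a_0 : Lambda_a 0 = 0 :> R.
Proof. by rewrite Lambda_aE mul0r cos0 expr1n acou_1. Qed.

Lemma Lambda_a_pi : Lambda_a pi = 10 :> R.
Proof. by rewrite Lambda_aE cos_pihalf expr0n acou_0. Qed.

Lemma Lambda_o_0 : Lambda_o 0 = 60 :> R.
Proof. by rewrite Lambda_oE mul0r cos0 expr1n opti_1. Qed.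

Lemma Lambda_o_pi : Lambda_o pi = 12 :> R.
Proof. by rewrite Lambda_oE cos_pihalf expr0n opti_0. Qed.

(** By the intermediate value theorem [Lambda_a] maps onto [0,10], so the partial inverse picks a
    genuine preimage; it differs from pi, where the value is 10. *)
Lemma Lambda_a_invP (L : R) : 0 <= L < 10 ->
  [/\ 0 <= Lambda_a_inv L, Lambda_a_inv L < pi & Lambda_a (Lambda_a_inv L) = L].
Proof.
move=> /andP[L0 L10].
have sj : set_surj `[0, pi] `[0, 10] (@Lambda_a R).
  have le : Lambda_a 0 <= Lambda_a pi :> R by rewrite Lambda_a_0 Lambda_a_pi.
  have := segment_continuous_le_surjective (pi_ge0 R) le continuous_Lambda_a.
  by rewrite Lambda_a_0 Lambda_a_pi.
have LI : `[0, 10]%classic L by rewrite /= in_itv /= L0 ltW.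
have e : Lambda_a (Lambda_a_inv L) = L by apply: (surjpK _ sj); rewrite inE.
have : `[0, pi]%classic (Lambda_a_inv L).
  by apply: (surjpinv_image_sub (dflt := fun=> 0) sj); exists L.
rewrite /= in_itv /= => /andP[h0 h1]; split => //.
rewrite lt_neqAle h1 andbT; apply/eqP => h.
by move: L10; rewrite -e h Lambda_a_pi ltxx.
Qed.

Lemma Lambda_o_invP (L : R) : 12 < L < 60 ->
  [/\ 0 < Lambda_o_inv L, Lambda_o_inv L < pi & Lambda_o (Lambda_o_inv L) = L].
Proof.
move=> /andP[L12 L60].
have sj : set_surj `[0, pi] `[12, 60] (@Lambda_o R).
  have le : Lambda_o pi <= Lambda_o 0 :> R by rewrite Lambda_o_0 Lambda_o_pi ler_nat.
  have := segment_continuous_ge_surjective (pi_ge0 R) le continuous_Lambda_o.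
  by rewrite Lambda_o_0 Lambda_o_pi.
have LI : `[12, 60]%classic L by rewrite /= in_itv /= !ltW.
have e : Lambda_o (Lambda_o_inv L) = L by apply: (surjpK _ sj); rewrite inE.
have : `[0, pi]%classic (Lambda_o_inv L).
  by apply: (surjpinv_image_sub (dflt := fun=> 0) sj); exists L.
rewrite /= in_itv /= => /andP[h0 h1]; split => //.
  rewrite lt_neqAle h0 andbT eq_sym; apply/eqP => h.
  by move: L60; rewrite -e h Lambda_o_0 ltxx.
rewrite lt_neqAle h1 andbT; apply/eqP => h.
by move: L12; rewrite -e h Lambda_o_pi ltxx.
Qed.

Lemma Lambda_o_inv_anti (L L' : R) : 12 < L < 60 -> 12 < L' < 60 -> L <= L' ->
  Lambda_o_inv L' <= Lambda_o_inv L.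
Proof.
move=> h h' LL; have [a0 a1 aE] := Lambda_o_invP h.
have [b0 b1 bE] := Lambda_o_invP h'; rewrite leNgt; apply/negP => lt.
move: LL; rewrite leNgt -aE -bE !Lambda_oE opti_lt //; first exact: sqr_ge0.
  rewrite ltrXn2r ?ltr_cos ?in_itv //=; try lra.
  by apply: cos_ge0_pihalf; lra.
Qed.

Section Truncation.
Variables La_p Lo_m Lo_p T : R.
Hypotheses (hLa_p : 0 < La_p < 10) (hLo_m : 12 < Lo_m < 60)
  (hLo_p : 12 < Lo_p < 60) (hLo : Lo_m <= Lo_p).

Let eta_a := Lambda_a_inv La_p.
Let eta_om := Lambda_o_inv Lo_m.
Let eta_op := Lambda_o_inv Lo_p.

Let eta_a_itv : 0 <= eta_a < pi.
Proof.
have /andP[h0 h1] := hLa_p; have [|-> -> _] := @Lambda_a_invP La_p; last by [].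
by rewrite h1 ltW.
Qed.

Let eta_o_itv : [/\ 0 < eta_op, eta_op <= eta_om & eta_om < pi].
Proof.
have [h0 _ _] := Lambda_o_invP hLo_p; have [_ h1 _] := Lambda_o_invP hLo_m.
by split => //; exact: Lambda_o_inv_anti.
Qed.

Let lambda_a_speed := inf [set deriv_on `[0, pi] (@lambda_a R) eta | eta in `[0, eta_a]].
Let lambda_o_speed := inf [set - deriv_on `[0, pi] (@lambda_o R) eta | eta in `[eta_op, eta_om]].

Let acou_speed_le eta : 0 <= eta <= eta_a -> lambda_a_speed <= dlambda_a eta.
Proof.
have /andP[ea0 ea1] := eta_a_itv; move=> /andP[e0 e1].
rewrite -deriv_on_lambda_a; last by rewrite e0 /=; lra.
(* An infimum is a lower bound once some lower bound is exhibited; here 0, by [dlambda_a_ge]. *)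
apply: ge_inf; last by exists eta => //=; rewrite in_itv /= e0.
exists 0 => _ [t /= + <-]; rewrite in_itv /= => /andP[t0 t1].
have tp : 0 <= t <= pi by rewrite t0 /=; lra.
rewrite deriv_on_lambda_a // (le_trans _ (dlambda_a_ge tp)) //.
by have [] := half_itv tp.
Qed.

Let opti_speed_le eta : eta_op <= eta <= eta_om -> lambda_o_speed <= - dlambda_o eta.
Proof.
have [w0 w1 w2] := eta_o_itv; move=> /andP[e0 e1].
rewrite -deriv_on_lambda_o; last by apply/andP; split; lra.
apply: ge_inf; last by exists eta => //=; rewrite in_itv /= e0.
exists 0 => _ [t /= + <-]; rewrite in_itv /= => /andP[t0 t1].
have tp : 0 <= t <= pi by apply/andP; split; lra.
rewrite deriv_on_lambda_o // (le_trans _ (dlambda_o_le tp)) //.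
by have [s c] := half_itv tp; rewrite divr_ge0 ?mulr_ge0.
Qed.

(** Positivity comes from an explicit lower bound, cos (eta_a / 2), positive because eta_a < pi.
    [opti_speed_gt0] proceeds in the same way from [dlambda_o_le]. *)
Let acou_speed_gt0 : 0 < lambda_a_speed.
Proof.
have /andP[ea0 ea1] := eta_a_itv; have p0 := pi_gt0 R.
apply: (@lt_le_trans _ _ (cos (eta_a / 2))); first by apply: cos_gt0_pihalf; lra.
apply: lb_le_inf.
  by exists (deriv_on `[0, pi] (@lambda_a R) 0), 0 => //=; rewrite in_itv /= lexx.
move=> _ [t /= + <-]; rewrite in_itv /= => /andP[t0 t1].
have tp : 0 <= t <= pi by rewrite t0 /=; lra.
rewrite deriv_on_lambda_a // (le_trans _ (dlambda_a_ge tp)) //.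
by apply: cos_half_mono => //; lra.
Qed.

Let sin_cos_half_ge eta : eta_op <= eta <= eta_om ->
  cos (eta_om / 2) <= cos (eta / 2) /\ sin (eta_op / 2) <= sin (eta / 2).
Proof.
move=> /andP[e0 e1]; have [w0 w1 w2] := eta_o_itv; have p0 := pi_gt0 R; split.
  by apply: cos_half_mono => //; lra.
rewrite leNgt ltr_sin ?in_itv /=; [by rewrite -leNgt; lra|lra|lra].
Qed.

Let half_gt0 : 0 < cos (eta_om / 2) /\ 0 < sin (eta_op / 2).
Proof.
have [w0 w1 w2] := eta_o_itv; have p0 := pi_gt0 R; split.
  by apply: cos_gt0_pihalf; lra.
by apply: sin_gt0_pi; lra.
Qed.

Let opti_speed_gt0 : 0 < lambda_o_speed.
Proof.
have [w0 w1 w2] := eta_o_itv; have [c0 s0] := half_gt0.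
apply: (@lt_le_trans _ _ (cos (eta_om / 2) * sin (eta_op / 2) / 4)).
  by rewrite divr_gt0 ?mulr_gt0.
apply: lb_le_inf.
  exists (- deriv_on `[0, pi] (@lambda_o R) eta_op), eta_op => //=.
  by rewrite in_itv /= lexx.
move=> _ [t /= + <-]; rewrite in_itv /= => tI; have /andP[t0 t1] := tI.
have tp : 0 <= t <= pi by apply/andP; split; lra.
rewrite deriv_on_lambda_o // (le_trans _ (dlambda_o_le tp)) //.
have [hc hs] := sin_cos_half_ge tI.
by rewrite ler_pM2r // ler_pM // ltW.
Qed.

(** [gamma] is the denominator of [Tstar], so [2 < gamma * T] restates the condition on T. The mean
    value theorem turns the bounds on derivatives into bounds on increments, the form in which gaps
    between sampled frequencies are read off. *)
Lemma uniform_group_velocity : Tstar eta_a eta_om eta_op < T ->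
  exists gamma : R, [/\ 0 < gamma <= 1, 2 < gamma * T,
    (forall x y, 0 <= x -> x <= y -> y <= eta_a ->
       gamma * (y - x) <= lambda_a y - lambda_a x) &
    (forall x y, eta_op <= x -> x <= y -> y <= eta_om ->
       gamma * (y - x) <= lambda_o x - lambda_o y)].
Proof.
rewrite /Tstar -/lambda_a_speed -/lambda_o_speed => hT.
have /andP[ea0 ea1] := eta_a_itv; have [w0 w1 w2] := eta_o_itv.
exists (Num.min lambda_a_speed lambda_o_speed); split.
- rewrite lt_min acou_speed_gt0 opti_speed_gt0 /= ge_min.
  by rewrite -dlambda_a_0 acou_speed_le // lexx.
- by rewrite mulrC -ltr_pdivrMr // lt_min acou_speed_gt0 opti_speed_gt0.
- move=> x y x0 xy ya; rewrite !lambda_aE; [|apply/andP; split; lra..].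
  apply: (@mean_value_ge _ (@dlambda_a R)) => // t.
    exact: is_derive_lambda_a_smooth.
  move=> /andP[t0 t1].
  by rewrite ge_min acou_speed_le //; apply/andP; split; lra.
- move=> x y x0 xy ya; rewrite !lambda_oE.
  have d (t : R) : is_derive t 1 (fun t => - Num.sqrt (opti_fun t)) (- dlambda_o t).
    exact: is_deriveN (is_derive_sqrt_opti t).
  have k t : x <= t <= y -> Num.min lambda_a_speed lambda_o_speed <= - dlambda_o t.
    move=> /andP[t0 t1].
    by rewrite ge_min opti_speed_le ?orbT //; apply/andP; split; lra.
  by have := mean_value_ge d k xy; lra.
Qed.

(* An eigenvector of wave number [eta] has value [+- sin eta] at [x_N] and
   squared mass norm at most [2 * (1 + kappa ^+ 2)]. *)
Lemma uniform_amplitude : exists K : R, 0 < K /\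
  let kappa (L : R) := (40 + L) / (4 * (10 - L)) in
  (forall eta, 0 <= eta <= eta_a ->
     Lambda_a eta * (1 + kappa (Lambda_a eta) ^+ 2) <= K * sin eta ^+ 2) /\
  (forall eta, eta_op <= eta <= eta_om ->
     Lambda_o eta * (1 + kappa (Lambda_o eta) ^+ 2) <= K * sin eta ^+ 2).
Proof.
have /andP[ea0 ea1] := eta_a_itv; have [w0 w1 w2] := eta_o_itv.
have p0 := pi_gt0 R; have [c0 s0] := half_gt0.
have /andP[L0 L10] := hLa_p.
have ca0 : 0 < cos (eta_a / 2) by apply: cos_gt0_pihalf; lra.
have sinE (eta : R) : sin eta ^+ 2 = 4 * (sin (eta / 2) ^+ 2 * cos (eta / 2) ^+ 2).
  rewrite {1}(_ : eta = (eta / 2) *+ 2); last by rewrite -mulr_natl; lra.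
  by rewrite sin_mulr2n; ring.
(* Origin of the constants: [ka] bounds kappa on the acoustic range, where 40 + L <= 50 and L <=
   La_p; 11 bounds Lambda_a / sin (eta / 2)^2, as [acou_den] >= 12; 60 bounds Lambda_o, and 13
   bounds |kappa| for L >= 12. The denominators come from sin eta^2 = 4 sin (eta / 2)^2 cos (eta /
   2)^2. On the acoustic side the vanishing sine cancels; on the optic side both factors are bounded
   below. *)
pose ka : R := 50 / (4 * (10 - La_p)).
pose Ka : R := 11 * (1 + ka ^+ 2) / (4 * cos (eta_a / 2) ^+ 2).
pose Ko : R := 60 * (1 + 13 ^+ 2) / (4 * (sin (eta_op / 2) ^+ 2 * cos (eta_om / 2) ^+ 2)).
have Ka0 : 0 < Ka.
  by rewrite /Ka divr_gt0 ?mulr_gt0 ?exprn_gt0 ?ltr_wpDr ?sqr_ge0.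
have Ko0 : 0 < Ko by rewrite /Ko divr_gt0 ?mulr_gt0 ?exprn_gt0 ?ltr_wpDr ?sqr_ge0.
exists (Num.max Ka Ko); split; first by rewrite lt_max Ka0.
move=> kappa; split => eta.
  move=> /andP[e0 e1]; apply: (@le_trans _ _ (Ka * sin eta ^+ 2)); last first.
    by rewrite ler_wpM2r ?sqr_ge0 // le_max lexx.
  have hc : cos (eta_a / 2) <= cos (eta / 2) by apply: cos_half_mono => //; lra.
  have Lp : Lambda_a eta <= La_p.
    have [|_ _ <-] := @Lambda_a_invP La_p; first by rewrite L10 ltW.
    rewrite !Lambda_aE acou_anti ?sqr_ge0 //.
    by rewrite lerXn2r ?nnegrE // ltW // (lt_le_trans ca0).
  have L0' : 0 <= Lambda_a eta by rewrite Lambda_aE acou_ge0 ?cos2_itv.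
  have L1 : Lambda_a eta <= 11 * sin (eta / 2) ^+ 2.
    rewrite Lambda_aE /acou -sin2cos2 -/(acou_den eta).
    have /andP[den12 _] := acou_den_itv eta; rewrite ler_pdivrMr; last by lra.
    have := sqr_ge0 (sin (eta / 2)); move: (sin _ ^+ 2) => S S0.
    by nra.
  have k1 : kappa (Lambda_a eta) ^+ 2 <= ka ^+ 2.
    rewrite lerXn2r ?nnegrE /kappa /ka ?divr_ge0 //; try lra.
    apply: ler_pM; rewrite ?invr_ge0; try lra.
    by rewrite lef_pV2 ?posrE; lra.
  apply: (@le_trans _ _ (11 * sin (eta / 2) ^+ 2 * (1 + ka ^+ 2))).
    by apply: ler_pM => //; rewrite ?addr_ge0 ?sqr_ge0 // lerD2l.
  have alg (S C c k : R) : c != 0 ->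
      11 * (1 + k) / (4 * c) * (4 * (S * C)) = 11 * S * (1 + k) * (C / c).
    by move=> nz; field.
  rewrite (sinE eta) /Ka alg ?gt_eqF ?exprn_gt0 //.
  have n0 : 0 <= 11 * sin (eta / 2) ^+ 2 * (1 + ka ^+ 2).
    exact: mulr_ge0 (mulr_ge0 (ler0n _ 11) (sqr_ge0 _)) (addr_ge0 ler01 (sqr_ge0 _)).
  have r1 : 1 <= cos (eta / 2) ^+ 2 / cos (eta_a / 2) ^+ 2.
    rewrite ler_pdivlMr ?exprn_gt0 // mul1r.
    by rewrite lerXn2r ?nnegrE // ltW // (lt_le_trans ca0).
  by rewrite ler_peMr.
move=> eI; apply: (@le_trans _ _ (Ko * sin eta ^+ 2)); last first.
  by rewrite ler_wpM2r ?sqr_ge0 // le_max lexx orbT.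
have [hc hs] := sin_cos_half_ge eI.
have L12 : 12 <= Lambda_o eta by rewrite Lambda_oE opti_ge12 ?cos2_itv.
have L60 : Lambda_o eta <= 60 by rewrite Lambda_oE opti_le60 ?cos2_itv.
have k1 : kappa (Lambda_o eta) ^+ 2 <= 13 ^+ 2.
  rewrite -sqrrN lerXn2r ?nnegrE /kappa //.
    by rewrite -mulrN -invrN mulr_ge0 ?invr_ge0; lra.
  by rewrite -mulrN -invrN ler_pdivrMr; lra.
apply: (@le_trans _ _ (60 * (1 + 13 ^+ 2))).
  apply: ler_pM => //; first by lra.
    by rewrite addr_ge0 ?sqr_ge0.
  by rewrite lerD2l.
have A0 : 0 <= 60 * (1 + 13 ^+ 2) :> R.
  exact: mulr_ge0 (ler0n _ 60) (addr_ge0 ler01 (sqr_ge0 _)).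
have cs0 : 0 < 4 * (sin (eta_op / 2) ^+ 2 * cos (eta_om / 2) ^+ 2).
  by rewrite !mulr_gt0 ?exprn_gt0.
rewrite /Ko mulrAC ler_pdivlMr // ler_wpM2l // (sinE eta) ler_pM2l //.
by apply: ler_pM; rewrite ?sqr_ge0 // lerXn2r ?nnegrE ?(ltW s0) ?(ltW c0)
  ?(le_trans (ltW s0) hs) ?(le_trans (ltW c0) hc).
Qed.

End Truncation.

End GroupVelocityBounds.

(** * Finite element matrices *)

Section PiecewiseIntegral.
Variable R : realType.
Local Notation mu := (@lebesgue_measure R).

Lemma integrable_eq_oo (a b : R) (F G : R -> R) :
    {in `]a, b[, F =1 G} -> continuous G ->
  mu.-integrable `[a, b] (EFin \o F).
Proof.
move=> FG cG.
have iG : mu.-integrable `[a, b] (EFin \o G).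
  by apply: continuous_integrable_itv; exact: continuous_subspaceT.
have iGo : mu.-integrable `]a, b[ (EFin \o G).
  by apply: integrableS iG => //; exact: subset_itv_oo_cc.
have iFo : mu.-integrable `]a, b[ (EFin \o F).
  by apply: eq_integrable iGo => // x; rewrite inE /= => xab; rewrite FG.
have mFo : measurable_fun `]a, b[ F.
  by apply/measurable_EFinP; case/integrableP : iFo.
apply/integrableP; split.
  by apply/measurable_EFinP; apply: measurable_fun_itv_cc mFo.
case/integrableP : iFo => mF; rewrite -(@integral_itv_bndoo _ _ _ _ true false) //.
by apply: measurableT_comp.
Qed.

Lemma integrable_disjU (A B : set R) (f : R -> R) :
    measurable A -> measurable B -> [disjoint A & B] ->
    mu.-integrable A (EFin \o f) -> mu.-integrable B (EFin \o f) ->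
  mu.-integrable (A `|` B) (EFin \o f).
Proof.
move=> mA mB AB /integrableP[mfA fA] /integrableP[mfB fB].
have mf : measurable_fun (A `|` B) (EFin \o f) by apply/measurable_funU.
apply/integrableP; split => //; rewrite ge0_integral_setU //.
  exact: lte_add_pinfty.
exact: measurableT_comp.
Qed.

(** F is compared with continuous functions on open pieces only, since the derivative of a basis
    function has no meaningful value at the nodes. *)
Lemma Rintegral_pieces (n : nat) (t : nat -> R) (F : R -> R) (G : nat -> R -> R) :
    (forall e, t e < t e.+1) -> (forall e, continuous (G e)) ->
    (forall e, (e < n)%N -> {in `]t e, t e.+1[, F =1 G e}) ->
  mu.-integrable `[t 0%N, t n] (EFin \o F) /\
  \int[mu]_(x in `[t 0%N, t n]) F x =
    \sum_(e < n) \int[mu]_(x in `[t e, t e.+1]) G e x.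
Proof.
move=> tS cG; elim: n => [_|n IH FG].
  split; last by rewrite big_ord0 set_itv1 Rintegral_set1.
  apply: (@integrable_eq_oo _ _ _ (cst 0)) => [x|x]; last exact: cst_continuous.
  by rewrite in_itv /= => /andP[/lt_trans h /h]; rewrite ltxx.
have [e en|iF intF] := IH; first by apply: FG; rewrite ltnS ltnW.
have t0n : t 0%N <= t n.
  by elim: (n) => // k /le_trans; apply; exact: ltW.
have U : `[t 0%N, t n.+1]%classic = `[t 0%N, t n] `|` `]t n, t n.+1].
  by apply: itv_bndbnd_setU; rewrite bnd_simp //; exact: ltW.
have D : [disjoint `[t 0%N, t n] & `]t n, t n.+1]]%classic.
  apply/disj_setPS => y [/=]; rewrite 2!in_itv/= => /andP[_ yx] /andP[].
  by rewrite ltNge yx.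
have iF2 : mu.-integrable `[t n, t n.+1] (EFin \o F).
  exact: integrable_eq_oo (FG n (ltnSn n)) (cG n).
have iF2' : mu.-integrable `]t n, t n.+1] (EFin \o F).
  by apply: integrableS iF2 => //; exact: subset_itv_oc_cc.
have iU := integrable_disjU (measurable_itv _) (measurable_itv _) D iF iF2'.
split; first by rewrite U.
rewrite U Rintegral_setU // intF big_ord_recr /=; congr (_ + _).
rewrite Rintegral_itv_obnd_cbnd //; congr fine.
have iF2o : mu.-integrable `]t n, t n.+1[ (EFin \o F).
  by apply: integrableS iF2 => //; exact: subset_itv_oo_cc.
have mF : measurable_fun `]t n, t n.+1[ F.
  by apply/measurable_EFinP; case/integrableP : iF2o.
have mG : measurable_fun `]t n, t n.+1[ (G n).
  by apply: measurable_funTS; exact: continuous_measurable_fun.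
exact: eq_integral_itv_bounded mF mG (FG n (ltnSn n)).
Qed.

Definition quad (c0 c1 c2 xi : R) : R := c0 + c1 * xi + c2 * xi ^+ 2.

Lemma continuous_quad_affine (c0 c1 c2 k d : R) :
  continuous (fun x : R => quad c0 c1 c2 (k * (x - d))).
Proof.
have cl : continuous (fun x : R => k * (x - d)).
  exact: is_derive1_continuous (fun x => is_derive1_affine x k d).
apply: continuous1D; last by apply: continuous1Z; exact: continuous1X.
by apply: continuous1D; [exact: cst_continuous|exact: continuous1Z].
Qed.

Lemma Rintegral_quad_mul (h d : R) (a0 a1 a2 b0 b1 b2 : R) : 0 < h ->
  \int[mu]_(x in `[d, d + h])
     (quad a0 a1 a2 (h^-1 * (x - d)) * quad b0 b1 b2 (h^-1 * (x - d))) =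
  h * (a0 * b0 + (a0 * b1 + a1 * b0) / 2 + (a0 * b2 + a1 * b1 + a2 * b0) / 3 +
       (a1 * b2 + a2 * b1) / 4 + a2 * b2 / 5).
Proof.
move=> h0.
(* The list holds the coefficients, in degrees 0 to 4, of the product of the two quadratics; P is
   its primitive in the local coordinate. *)
pose P x : R := \sum_(k < 5)
  ([:: a0 * b0; a0 * b1 + a1 * b0; a0 * b2 + a1 * b1 + a2 * b0;
       a1 * b2 + a2 * b1; a2 * b2]`_k) * (h / k.+1%:R) * (h^-1 * (x - d)) ^+ k.+1.
transitivity (P (d + h) - P d).
  apply: Rintegral_FTC2; first by rewrite ltrDl.
    by apply: continuous1M; exact: continuous_quad_affine.
  move=> x; rewrite (_ : _ * _ = \sum_(k < 5)
    ([:: a0 * b0; a0 * b1 + a1 * b0; a0 * b2 + a1 * b1 + a2 * b0;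
       a1 * b2 + a2 * b1; a2 * b2]`_k) * (h / k.+1%:R) *
       (k.+1%:R * (h^-1 * (x - d)) ^+ k * h^-1)); last first.
    rewrite !big_ord_recl big_ord0 /= /quad /bump /=.
    by field; rewrite gt_eqF.
  apply: is_derive1_sum => k; apply: is_derive1Z.
  have := is_derive1_affine x h^-1 d => dl.
  exact: (is_derive1X k.+1 dl).
have e1 : h^-1 * (d + h - d) = 1 by field; rewrite gt_eqF.
have e0 : h^-1 * (d - d) = 0 by rewrite subrr mulr0.
rewrite /P e1 e0 !big_ord_recl !big_ord0 /= /bump /= !expr1n !expr0n /=.
by field.
Qed.

End PiecewiseIntegral.

(** * Restriction of the basis to an element and element matrices *)

Section ElementMatrices.
Variables (R : realType) (N : nat).
Local Notation mu := (@lebesgue_measure R).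
Local Notation h := (mesh R N).
Local Notation node := (node R N).

Lemma mesh_gt0 : 0 < h.
Proof. by rewrite /mesh invr_gt0 ltr0n. Qed.

Lemma meshSN : h * N.+1%:R = 1.
Proof. by rewrite /mesh mulVf // pnatr_eq0. Qed.

Lemma node_double e : node e.*2 = e%:R * h.
Proof. by rewrite /Defs.node -muln2 natrM mulfK ?pnatr_eq0. Qed.

Lemma node_doubleS e : node e.*2.+1 = (e%:R + 2^-1) * h.
Proof. by rewrite /Defs.node -addn1 natrD -muln2 natrM; congr (_ * _); field. Qed.

Lemma node_double_lt e : node e.*2 < node e.+1.*2.
Proof. by rewrite !node_double ltr_pM2r ?mesh_gt0 // ltr_nat. Qed.

(** Value of the basis function of index m at the left end, midpoint or right end (a = 0, 1, 2) of
    the element e: a Kronecker delta, the basis being nodal. *)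
Definition vertex (e a m : nat) : R := (m == e.*2 + a)%:R.

(* Coefficients, in the local coordinate of the element [e], of the restriction
   to it of the continuous piecewise quadratic function whose nodal values at
   its left end, midpoint and right end are [c0], [c1], [c2]. *)
Definition lin_coef (c0 c1 c2 : R) : R := - (3 * c0) + 4 * c1 - c2.
Definition sqr_coef (c0 c1 c2 : R) : R := 2 * c0 - 4 * c1 + 2 * c2.

Definition local_phi (m e : nat) (xi : R) : R :=
  quad (vertex e 0 m) (lin_coef (vertex e 0 m) (vertex e 1 m) (vertex e 2 m))
    (sqr_coef (vertex e 0 m) (vertex e 1 m) (vertex e 2 m)) xi.

(** Inside the open element, every comparison of x with a vertex in the definition of [phi] is
    settled by comparing element indices; each surviving case is a polynomial identity in the local
    coordinate [xi]. *)
Lemma phi_local m e x : (0 < m)%N -> x \in `]node e.*2, node e.+1.*2[ ->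
  phi N m x = local_phi m e (h^-1 * (x - node e.*2)).
Proof.
have h0 := mesh_gt0; move=> m0; rewrite in_itv /= !node_double => /andP[ex xe].
set xi := h^-1 * _; have xE : x = (e%:R + xi) * h.
  by rewrite /xi; field; rewrite gt_eqF.
clearbody xi; subst x; move: ex xe; rewrite !ltr_pM2r // => ex xe.
have xi0 : 0 < xi by rewrite -(ltrD2l e%:R) addr0.
have xi1 : xi < 1 by rewrite -(ltrD2l e%:R) (lt_le_trans xe) // -natr1.
have below f : (e < f)%N -> (f%:R * h <= (e%:R + xi) * h) = false.
  move=> ef; apply/negbTE; rewrite -ltNge ltr_pM2r // (lt_le_trans xe) //.
  by rewrite ler_nat.
have above f : (f < e.+1)%N -> ((e%:R + xi) * h <= f%:R * h) = false.
  move=> ef; apply/negbTE; rewrite -ltNge ltr_pM2r // (le_lt_trans _ ex) //.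
  by rewrite ler_nat.
have low f : (f <= e)%N -> (f%:R * h <= (e%:R + xi) * h) = true.
  by move=> ef; rewrite ler_pM2r // ltW // (le_lt_trans _ ex) // ler_nat.
have high f : (e < f)%N -> ((e%:R + xi) * h <= f%:R * h) = true.
  by move=> ef; rewrite ler_pM2r // ltW // (lt_le_trans xe) // ler_nat.
have nz : h != 0 by rewrite gt_eqF.
rewrite /phi /local_phi /lin_coef /sqr_coef /vertex.
have [om|em] := boolP (odd m).
  have [f ->] : exists f, m = f.*2.+1 by exists m./2; lia.
  rewrite [f.*2.+1.-1]/= (_ : f.*2.+2 = f.+1.*2) // !node_double.
  have -> : (f.*2.+1 == e.*2 + 0)%N = false by lia.
  have -> : (f.*2.+1 == e.*2 + 2)%N = false by lia.
  have [fe|ef|fe] := ltngtP f e.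
  - rewrite low ?(ltnW fe) // above //= (_ : (_ == _) = false); last by lia.
    by rewrite /quad /=; ring.
  - rewrite below //= (_ : (_ == _) = false); last by lia.
    by rewrite /quad /=; ring.
  - subst f; rewrite low // high //= (_ : (_ == _) = true); last by lia.
    by rewrite -natr1 /quad /=; field.
(* A positive even index is the vertex f + 1, whose basis function lives on the elements f and f +
   1. *)
have [f ->] : exists f, m = f.+1.*2 by exists m./2.-1; lia.
rewrite (_ : f.+1.*2.-2 = f.*2) // (_ : f.+1.*2.-1 = f.*2.+1) //.
rewrite (_ : f.+1.*2.+2 = f.+2.*2) // !node_double !node_doubleS.
have -> : (f.+1.*2 == e.*2 + 1)%N = false by lia.
have [fe|ef|fe] := ltngtP f e.
- rewrite (above f.+1) // andbF low //=.
  have [fe1|ef1|fe1] := ltngtP f.+1 e.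
  + rewrite above //= (_ : (_ == e.*2 + 0)%N = false); last by lia.
    rewrite (_ : (_ == e.*2 + 2)%N = false); last by lia.
    by rewrite /quad /=; ring.
  + by lia.
  + rewrite high; last by lia.
    rewrite (_ : (_ == e.*2 + 0)%N = true); last by lia.
    rewrite (_ : (_ == e.*2 + 2)%N = false); last by lia.
    by rewrite -fe1 -natr1 -[f.+1%:R]natr1 /quad /=; field.
- rewrite below //= below; last by lia.
  rewrite /= (_ : (_ == e.*2 + 0)%N = false); last by lia.
  rewrite (_ : (_ == e.*2 + 2)%N = false); last by lia.
  by rewrite /quad /=; ring.
- subst f; rewrite low // high //= (_ : (_ == e.*2 + 0)%N = false); last by lia.
  rewrite (_ : (_ == e.*2 + 2)%N = true); last by lia.
  by rewrite /quad /=; field.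
Qed.

Lemma derive1_phi_local m e x : (0 < m)%N -> x \in `]node e.*2, node e.+1.*2[ ->
  derive1 (phi N m) x = quad
    (h^-1 * lin_coef (vertex e 0 m) (vertex e 1 m) (vertex e 2 m))
    (2 * h^-1 * sqr_coef (vertex e 0 m) (vertex e 1 m) (vertex e 2 m)) 0
    (h^-1 * (x - node e.*2)).
Proof.
move=> m0 xI.
pose g y : R := local_phi m e (h^-1 * (y - node e.*2)).
have dg : is_derive x 1 g (0 +
    lin_coef (vertex e 0 m) (vertex e 1 m) (vertex e 2 m) * h^-1 +
    sqr_coef (vertex e 0 m) (vertex e 1 m) (vertex e 2 m) *
      (2%:R * (h^-1 * (x - node e.*2)) ^+ 1 * h^-1)).
  have dl := is_derive1_affine x h^-1 (node e.*2).
  exact: (is_derive1D (is_derive1D (is_derive_cst _ _ _) (is_derive1Z _ dl))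
    (is_derive1Z _ (is_derive1X 2 dl))).
have : is_derive x 1 (phi N m) _ := near_eq_is_derive _ dg.
rewrite derive1E => -[].
  near=> y; rewrite /g (phi_local (e := e)) //.
  by near: y; exact: near_in_itvoo.
by move=> _ ->; rewrite /quad expr1; ring.
Unshelve. all: by end_near. Qed.

(** [mass_form] and [stiff_form] are the quadratic element matrices on the unit interval, as
    bilinear forms in the nodal values at left end, midpoint and right end. An element of length h
    multiplies them by h and 1 / h. *)
Definition mass_form (c0 c1 c2 d0 d1 d2 : R) : R :=
  (4 * c0 * d0 + 2 * c0 * d1 - c0 * d2 + 2 * c1 * d0 + 16 * c1 * d1 +
   2 * c1 * d2 - c2 * d0 + 2 * c2 * d1 + 4 * c2 * d2) / 30.

Definition stiff_form (c0 c1 c2 d0 d1 d2 : R) : R :=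
  (7 * c0 * d0 - 8 * c0 * d1 + c0 * d2 - 8 * c1 * d0 + 16 * c1 * d1 -
   8 * c1 * d2 + c2 * d0 - 8 * c2 * d1 + 7 * c2 * d2) / 3.

Lemma Rintegral_elements (F : R -> R) (a0 a1 a2 b0 b1 b2 : nat -> R) :
    (forall e, (e <= N)%N -> {in `]node e.*2, node e.+1.*2[, F =1 fun x =>
       quad (a0 e) (a1 e) (a2 e) (h^-1 * (x - node e.*2)) *
       quad (b0 e) (b1 e) (b2 e) (h^-1 * (x - node e.*2))}) ->
  \int[mu]_(x in `[0, 1]) F x = \sum_(e < N.+1) h *
    (a0 e * b0 e + (a0 e * b1 e + a1 e * b0 e) / 2 +
     (a0 e * b2 e + a1 e * b1 e + a2 e * b0 e) / 3 +
     (a1 e * b2 e + a2 e * b1 e) / 4 + a2 e * b2 e / 5).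
Proof.
move=> FG; pose G e x := quad (a0 e) (a1 e) (a2 e) (h^-1 * (x - node e.*2)) *
       quad (b0 e) (b1 e) (b2 e) (h^-1 * (x - node e.*2)).
have cG e : continuous (G e) by apply: continuous1M; exact: continuous_quad_affine.
have [_] := @Rintegral_pieces R N.+1 (fun e => node e.*2) F G node_double_lt cG FG.
rewrite !node_double mul0r mulrC meshSN => ->; apply: eq_bigr => e _.
rewrite -(@Rintegral_quad_mul R h (node e.*2)) ?mesh_gt0 //.
by have -> : node e.+1.*2 = node e.*2 + h by rewrite !node_double -natr1 mulrDl mul1r.
Qed.

Lemma massRE i j : massR R N i j = \sum_(e < N.+1) h * mass_form
  (vertex e 0 i.+1) (vertex e 1 i.+1) (vertex e 2 i.+1)
  (vertex e 0 j.+1) (vertex e 1 j.+1) (vertex e 2 j.+1).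
Proof.
rewrite mxE.
rewrite (Rintegral_elements (F := fun x => phi N i.+1 x * phi N j.+1 x)
  (a0 := fun e => vertex e 0 i.+1)
  (a1 := fun e => lin_coef (vertex e 0 i.+1) (vertex e 1 i.+1) (vertex e 2 i.+1))
  (a2 := fun e => sqr_coef (vertex e 0 i.+1) (vertex e 1 i.+1) (vertex e 2 i.+1))
  (b0 := fun e => vertex e 0 j.+1)
  (b1 := fun e => lin_coef (vertex e 0 j.+1) (vertex e 1 j.+1) (vertex e 2 j.+1))
  (b2 := fun e => sqr_coef (vertex e 0 j.+1) (vertex e 1 j.+1) (vertex e 2 j.+1))).
  apply: eq_bigr => e _; congr (_ * _).
  by rewrite /mass_form /lin_coef /sqr_coef; field.
by move=> e _ x xI; rewrite (phi_local (e := e)) // (phi_local (e := e)).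
Qed.

Lemma stiffRE i j : stiffR R N i j = \sum_(e < N.+1) h^-1 * stiff_form
  (vertex e 0 i.+1) (vertex e 1 i.+1) (vertex e 2 i.+1)
  (vertex e 0 j.+1) (vertex e 1 j.+1) (vertex e 2 j.+1).
Proof.
rewrite mxE.
rewrite (Rintegral_elements (F := fun x => derive1 (phi N i.+1) x * derive1 (phi N j.+1) x)
  (a0 := fun e => h^-1 * lin_coef (vertex e 0 i.+1) (vertex e 1 i.+1) (vertex e 2 i.+1))
  (a1 := fun e => 2 * h^-1 * sqr_coef (vertex e 0 i.+1) (vertex e 1 i.+1) (vertex e 2 i.+1))
  (a2 := fun e => 0)
  (b0 := fun e => h^-1 * lin_coef (vertex e 0 j.+1) (vertex e 1 j.+1) (vertex e 2 j.+1))
  (b1 := fun e => 2 * h^-1 * sqr_coef (vertex e 0 j.+1) (vertex e 1 j.+1) (vertex e 2 j.+1))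
  (b2 := fun e => 0)).
  apply: eq_bigr => e _; have := mesh_gt0.
  by rewrite /stiff_form /lin_coef /sqr_coef => h0; field; rewrite gt_eqF.
by move=> e _ x xI; rewrite (derive1_phi_local (e := e)) // (derive1_phi_local (e := e)).
Qed.

End ElementMatrices.

(** * Assembled matrices and discrete eigenmodes *)

Section AssembledForms.
Variables (R : realType) (N : nat).
Local Notation h := (mesh R N).
Local Notation rvec := 'cV[R]_(N.*2.+1).

(** Extension of the components by zero, which encodes the boundary convention F_0 = F_{N+1} = 0.
    Written as a sum against deltas, it arises directly when matrix entries are summed element by
    element. *)
Definition nodal (F : rvec) (m : nat) : R := \sum_(i < N.*2.+1) (i.+1 == m)%:R * F i 0.

Definition dotR (F G : rvec) : R := \sum_i F i 0 * G i 0.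

Lemma nodal_ord (F : rvec) (i : 'I_(N.*2.+1)) : nodal F i.+1 = F i 0.
Proof.
rewrite /nodal (bigD1 i) //= eqxx mul1r big1 ?addr0 // => j ji.
by rewrite eqSS (negbTE (_ : nat_of_ord j != i)) ?mul0r.
Qed.

Lemma nodal_out (F : rvec) m : (m == 0%N) || (N.*2.+1 < m)%N -> nodal F m = 0.
Proof.
move=> hm; rewrite /nodal big1 // => i _.
rewrite (_ : (_ == _) = false) ?mul0r //; have := ltn_ord i.
by case/orP : hm => [/eqP ->|]; lia.
Qed.

Lemma nodal_col (y : nat -> R) m : y 0%N = 0 -> y N.*2.+2 = 0 ->
  (m <= N.*2.+2)%N -> nodal (\col_i y i.+1) m = y m.
Proof.
move=> y0 yN mN; have [->|m0] := eqVneq m 0%N; first by rewrite nodal_out.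
have [->|mN'] := eqVneq m N.*2.+2; first by rewrite yN nodal_out // ltnSn orbT.
have hm : (m.-1 < N.*2.+1)%N by lia.
rewrite (_ : m = (Ordinal hm).+1) ?nodal_ord ?mxE //=; lia.
Qed.

Section Form.
Variables (f : R -> R -> R -> R -> R -> R -> R) (k : R) (A : 'M[R]_(N.*2.+1)).
Hypothesis f_lin : forall c0 c1 c2 d0 d1 d2, f c0 c1 c2 d0 d1 d2 =
  d0 * f c0 c1 c2 1 0 0 + d1 * f c0 c1 c2 0 1 0 + d2 * f c0 c1 c2 0 0 1.
Hypothesis f_sym : forall c0 c1 c2 d0 d1 d2,
  f c0 c1 c2 d0 d1 d2 = f d0 d1 d2 c0 c1 c2.
Hypothesis AE : forall i j, A i j = \sum_(e < N.+1) k * f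
  (vertex R e 0 i.+1) (vertex R e 1 i.+1) (vertex R e 2 i.+1)
  (vertex R e 0 j.+1) (vertex R e 1 j.+1) (vertex R e 2 j.+1).

(** By linearity in the second triple, summing the deltas against F yields the nodal values on the
    element; the zero extension handles the first and last elements. *)
Lemma form_sum (F : rvec) e c0 c1 c2 :
  \sum_(j < N.*2.+1) f c0 c1 c2 (vertex R e 0 j.+1) (vertex R e 1 j.+1) (vertex R e 2 j.+1) * F j 0 =
  f c0 c1 c2 (nodal F (e.*2 + 0)) (nodal F (e.*2 + 1)) (nodal F (e.*2 + 2)).
Proof.
rewrite [RHS]f_lin /nodal !mulr_suml -!big_split /=; apply: eq_bigr => j _.
rewrite f_lin /vertex; ring.
Qed.

Lemma assembled_mul (F : rvec) i : (A *m F) i 0 = \sum_(e < N.+1) k * f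
  (vertex R e 0 i.+1) (vertex R e 1 i.+1) (vertex R e 2 i.+1)
  (nodal F (e.*2 + 0)) (nodal F (e.*2 + 1)) (nodal F (e.*2 + 2)).
Proof.
rewrite mxE; under eq_bigr do rewrite AE mulr_suml.
rewrite exchange_big /=; apply: eq_bigr => e _.
by rewrite -form_sum mulr_sumr; apply: eq_bigr => j _; rewrite mulrA.
Qed.

Lemma assembled_dot (F G : rvec) : dotR F (A *m G) = \sum_(e < N.+1) k * f
  (nodal F (e.*2 + 0)) (nodal F (e.*2 + 1)) (nodal F (e.*2 + 2))
  (nodal G (e.*2 + 0)) (nodal G (e.*2 + 1)) (nodal G (e.*2 + 2)).
Proof.
rewrite /dotR; under eq_bigr do rewrite assembled_mul mulr_sumr.
rewrite exchange_big /=; apply: eq_bigr => e _.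
rewrite [in RHS]f_sym -form_sum mulr_sumr; apply: eq_bigr => j _.
by rewrite f_sym; ring.
Qed.

Lemma assembled_sym (F G : rvec) : dotR F (A *m G) = dotR G (A *m F).
Proof. by rewrite !assembled_dot; apply: eq_bigr => e _; rewrite f_sym. Qed.

End Form.

Lemma mass_form_lin c0 c1 c2 d0 d1 d2 : mass_form c0 c1 c2 d0 d1 d2 =
  d0 * mass_form c0 c1 c2 1 0 0 + d1 * mass_form c0 c1 c2 0 1 0 +
  d2 * mass_form c0 c1 c2 0 0 1 :> R.
Proof. by rewrite /mass_form; field. Qed.

Lemma mass_form_sym c0 c1 c2 d0 d1 d2 :
  mass_form c0 c1 c2 d0 d1 d2 = mass_form d0 d1 d2 c0 c1 c2 :> R.
Proof. by rewrite /mass_form; field. Qed.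

Lemma stiff_form_lin c0 c1 c2 d0 d1 d2 : stiff_form c0 c1 c2 d0 d1 d2 =
  d0 * stiff_form c0 c1 c2 1 0 0 + d1 * stiff_form c0 c1 c2 0 1 0 +
  d2 * stiff_form c0 c1 c2 0 0 1 :> R.
Proof. by rewrite /stiff_form; field. Qed.

Lemma stiff_form_sym c0 c1 c2 d0 d1 d2 :
  stiff_form c0 c1 c2 d0 d1 d2 = stiff_form d0 d1 d2 c0 c1 c2 :> R.
Proof. by rewrite /stiff_form; field. Qed.

Definition massR_mul := assembled_mul mass_form_lin (@massRE R N).
Definition stiffR_mul := assembled_mul stiff_form_lin (@stiffRE R N).
Definition massR_dot := assembled_dot mass_form_lin mass_form_sym (@massRE R N).
Definition stiffR_dot := assembled_dot stiff_form_lin stiff_form_sym (@stiffRE R N).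
Definition massR_sym := assembled_sym mass_form_lin mass_form_sym (@massRE R N).
Definition stiffR_sym := assembled_sym stiff_form_lin stiff_form_sym (@stiffRE R N).

(** The element matrix has least eigenvalue (19 - sqrt 201) / 60, above 1/15, and its largest, (19 +
    sqrt 201) / 60, is below the 2/3 of [mass_form_le]. Both bounds are sums of squares. *)
Lemma mass_form_ge c0 c1 c2 :
  (c0 ^+ 2 + c1 ^+ 2 + c2 ^+ 2) / 15 <= mass_form c0 c1 c2 c0 c1 c2 :> R.
Proof.
have := (sqr_ge0 (c0 + 2 * c1), sqr_ge0 (c2 + 2 * c1), sqr_ge0 c1, sqr_ge0 (c0 - c2)).
by move=> [[[h1 h2] h3] h4]; rewrite /mass_form; lra.
Qed.

Lemma mass_form_le c0 c1 c2 :
  mass_form c0 c1 c2 c0 c1 c2 <= 2 / 3 * (c0 ^+ 2 + c1 ^+ 2 + c2 ^+ 2) :> R.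
Proof.
have := (sqr_ge0 (c0 - c1), sqr_ge0 (c2 - c1), sqr_ge0 c0, sqr_ge0 c2, sqr_ge0 (c0 + c2)).
by move=> [[[[h1 h2] h3] h4] h5]; rewrite /mass_form; lra.
Qed.

Lemma stiff_form_ge0 c0 c1 c2 : 0 <= stiff_form c0 c1 c2 c0 c1 c2 :> R.
Proof.
have := (sqr_ge0 (c0 + c2 - 2 * c1), sqr_ge0 (c0 - c2)).
by move=> [h1 h2]; rewrite /stiff_form; lra.
Qed.

Lemma stiffR_ge0 (F : rvec) : 0 <= dotR F (stiffR R N *m F).
Proof.
rewrite stiffR_dot; apply: sumr_ge0 => e _.
by rewrite mulr_ge0 ?stiff_form_ge0 // invr_ge0 ltW // mesh_gt0.
Qed.

Lemma mass_form_ge0 c0 c1 c2 : 0 <= mass_form c0 c1 c2 c0 c1 c2 :> R.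
Proof. by apply: le_trans (mass_form_ge _ _ _); rewrite divr_ge0 ?addr_ge0 ?sqr_ge0. Qed.

Lemma massR_ge0 (F : rvec) : 0 <= dotR F (massR R N *m F).
Proof.
rewrite massR_dot; apply: sumr_ge0 => e _.
by rewrite mulr_ge0 ?mass_form_ge0 // ltW // mesh_gt0.
Qed.

Lemma massR_eq0 (F : rvec) : dotR F (massR R N *m F) = 0 -> F = 0.
Proof.
rewrite massR_dot => /eqP; rewrite psumr_eq0 => [/allP H|e _]; last first.
  by rewrite mulr_ge0 ?mass_form_ge0 // ltW // mesh_gt0.
apply/matrixP => i j; rewrite ord1 mxE -nodal_ord.
(* The node of index [i.+1] is the left end or the midpoint of the element [i.+1./2], according to
   parity; the vanishing of that element's form kills both values. *)
have e_lt : (i.+1./2 < N.+1)%N by have := ltn_ord i; lia.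
have := H (Ordinal e_lt); rewrite mem_index_enum => /(_ isT) /=.
rewrite mulf_eq0 (gt_eqF (mesh_gt0 _ _)) /= => /eqP m0.
set c0 := nodal F _ in m0; set c1 := nodal F _ in m0; set c2 := nodal F _ in m0.
have := mass_form_ge c0 c1 c2; rewrite m0.
have := (sqr_ge0 c0, sqr_ge0 c1) => -[s0 s1] s.
have := sqr_ge0 c2 => s2.
have z0 : c0 = 0 by apply/eqP; rewrite -sqrf_eq0 eq_le s0 andbT; lra.
have z1 : c1 = 0 by apply/eqP; rewrite -sqrf_eq0 eq_le s1 andbT; lra.
have [od|ev] := boolP (odd i.+1).
  by rewrite -z1 /c1; congr nodal; lia.
by rewrite -z0 /c0; congr nodal; lia.
Qed.

(** Each element contributes at most h * (2/3) * 3 B, and the N + 1 elements have total length 1. *)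
Lemma massR_le (F : rvec) (B : R) : (forall m, nodal F m ^+ 2 <= B) ->
  dotR F (massR R N *m F) <= 2 * B.
Proof.
move=> FB; have h0 := mesh_gt0 R N; rewrite massR_dot.
apply: (@le_trans _ _ (\sum_(e < N.+1) h * (2 * B))).
  apply: ler_sum => e _; rewrite ler_wpM2l ?(ltW h0) //.
  apply: (le_trans (mass_form_le _ _ _)).
  have := (FB (e.*2 + 0)%N, FB (e.*2 + 1)%N, FB (e.*2 + 2)%N) => -[[b0 b1] b2].
  lra.
by rewrite sumr_const card_ord -[leLHS]mulr_natr mulrAC meshSN mul1r.
Qed.

Lemma vertex_sum a f (r : nat -> R) : (f < N.+1)%N ->
  \sum_(e < N.+1) vertex R e a (f.*2 + a) * r e = r f.
Proof.
move=> fN; rewrite (bigD1 (Ordinal fN)) //= /vertex eqxx mul1r big1 ?addr0 // => e ef.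
rewrite (_ : (_ == _) = false) ?mul0r //.
by apply/negbTE; apply: contraNneq ef => ef; apply/eqP/val_inj => /=; lia.
Qed.

Lemma vertex_sum0 a m (r : nat -> R) : odd m != odd a ->
  \sum_(e < N.+1) vertex R e a m * r e = 0.
Proof.
move=> om; rewrite big1 // => e _; rewrite /vertex (_ : (_ == _) = false) ?mul0r //.
by apply/negbTE; apply: contraNneq om => ->; rewrite oddD odd_double.
Qed.

(* [theta] is half the wave number and [L] the eigenvalue of the dispersion
   relation at [cos theta ^+ 2]. *)
Definition mode (theta L : R) (m : nat) : R :=
  if odd m then (40 + L) / (4 * (10 - L)) * cos theta * sin (m%:R * theta)
  else sin (m%:R * theta).

(** A midpoint row involves one element and reduces to the definition of the midpoint factor [kap].
    A vertex row involves two neighbouring elements; the addition formulas, multiplication by 10 - L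
    and elimination of [kap] leave a multiple of the dispersion relation. *)
Lemma mode_eigen (theta L : R) :
    dispersion (cos theta ^+ 2) L -> L != 10 -> sin (N.*2.+2%:R * theta) = 0 ->
  let psi : rvec := \col_i mode theta L i.+1 in
  stiffR R N *m psi = (L / h ^+ 2) *: (massR R N *m psi).
Proof.
move=> disp L10 end0 psi.
have nz : 10 - L != 0 by rewrite subr_eq0 eq_sym.
have h0 := mesh_gt0 R N; have hn : h != 0 by rewrite gt_eqF.
set kap := (40 + L) / (4 * (10 - L)).
have kapE : 4 * (10 - L) * kap = 40 + L by rewrite /kap; field.
(* The sine vanishes at both ends of the interval, so the zero extension agrees with the sine
   formula there and the first and last rows need no separate computation. *)
have psiE m : (m <= N.*2.+2)%N -> nodal psi m = mode theta L m.
  apply: nodal_col; first by rewrite /mode /= mul0r sin0.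
  by rewrite /mode /= negbK odd_double end0.
pose Y (e a : nat) := mode theta L (e.*2 + a).
pose r e c0 c1 c2 : R := stiff_form c0 c1 c2 (Y e 0%N) (Y e 1%N) (Y e 2%N) -
   L * mass_form c0 c1 c2 (Y e 0%N) (Y e 1%N) (Y e 2%N).
have r_lin e c0 c1 c2 : r e c0 c1 c2 = c0 * r e 1 0 0 + c1 * r e 0 1 0 + c2 * r e 0 0 1.
  by rewrite /r /stiff_form /mass_form; field.
apply/matrixP => i j; rewrite ord1 [RHS]mxE stiffR_mul massR_mul.
apply/eqP; rewrite -subr_eq0 mulr_sumr -sumrB.
rewrite (eq_bigr (fun e : 'I_N.+1 => h^-1 * (vertex R e 0 i.+1 * r e 1 0 0 +
    vertex R e 1 i.+1 * r e 0 1 0 + vertex R e 2 i.+1 * r e 0 0 1))); last first.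
  move=> e _; rewrite -r_lin /r !psiE; [|by have := ltn_ord e; lia..].
  by rewrite -/(Y e 0%N) -/(Y e 1%N) -/(Y e 2%N); field.
rewrite -mulr_sumr !big_split /=.
have iN := ltn_ord i.
have odd_e (e : nat) a : odd (e.*2 + a) = odd a by rewrite oddD odd_double.
have [om|em] := boolP (odd i.+1).
  have [f fE] : exists f, i.+1 = (f.*2 + 1)%N by exists i./2; lia.
  rewrite (@vertex_sum0 0 i.+1 (fun e => r e 1 0 0)) ?om //.
  rewrite (@vertex_sum0 2 i.+1 (fun e => r e 0 0 1)) ?om // fE.
  rewrite (@vertex_sum 1 _ (fun e => r e 0 1 0)); last by lia.
  rewrite add0r addr0 mulf_eq0 invr_eq0 (negbTE hn) /= /r /Y /mode !odd_e /=.
  rewrite -/kap.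
  have s0 : (f.*2 + 0)%:R * theta = (f.*2 + 1)%:R * theta - theta :> R.
    by rewrite !natrD; ring.
  have s2 : (f.*2 + 2)%:R * theta = (f.*2 + 1)%:R * theta + theta :> R.
    by rewrite !natrD; ring.
  rewrite s0 s2 sinB sinD; move: (sin (_ * _)) (cos (_ * _)) => S C.
  rewrite /stiff_form /mass_form; apply/eqP.
  transitivity (cos theta * S / 15 * (2 * (4 * (10 - L) * kap) - 2 * (40 + L))).
    by field.
  by rewrite kapE subrr mulr0.
have [f fE] : exists f, i.+1 = (f.*2 + 2)%N by exists i./2; lia.
have fE' : (f.*2 + 2)%N = (f.+1.*2 + 0)%N by lia.
rewrite (@vertex_sum0 1 i.+1 (fun e => r e 0 1 0)) ?(negbTE em) // fE.
rewrite (@vertex_sum 2 _ (fun e => r e 0 0 1)); last by lia.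
rewrite fE' (@vertex_sum 0 _ (fun e => r e 1 0 0)); last by lia.
rewrite addr0 mulf_eq0 invr_eq0 (negbTE hn) /= /r /Y /mode !odd_e /= -/kap.
set phi := (f.+1.*2 + 0)%:R * theta.
have s2 : (f.*2 + 2)%:R * theta = phi by rewrite /phi fE'.
have s0 : (f.*2 + 0)%:R * theta = phi - (theta + theta).
  by rewrite -s2 !natrD; ring.
have s1 : (f.*2 + 1)%:R * theta = phi - theta by rewrite -s2 !natrD; ring.
have s3 : (f.+1.*2 + 1)%:R * theta = phi + theta by rewrite /phi !natrD; ring.
have s4 : (f.+1.*2 + 2)%:R * theta = phi + (theta + theta).
  by rewrite /phi !natrD; ring.
rewrite s0 s1 s2 s3 s4 !sinB !sinD !cosD.
have := cos2Dsin2 theta; move: disp; rewrite /dispersion.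
move: (sin phi) (cos phi) (cos theta) (sin theta) => S C c s disp cs.
have {}cs : s * s = 1 - c ^+ 2 by rewrite -cs; ring.
rewrite /stiff_form /mass_form cs; apply/eqP; apply: (mulfI nz); rewrite [RHS]mulr0.
transitivity (S / 30 * ((10 - L) * (10 * (12 + 4 * c ^+ 2) - L * (10 - 4 * c ^+ 2)) -
    c ^+ 2 * (40 + L) * (4 * (10 - L) * kap))); first by field.
rewrite kapE.
transitivity (S / 6 * ((2 - c ^+ 2) * L ^+ 2 - (44 + 16 * c ^+ 2) * L +
    240 * (1 - c ^+ 2))); first by field.
by rewrite disp mulr0.
Qed.

End AssembledForms.

(** * Observability of real solutions *)

Section RealObservability.
Variables (R : realType) (N : nat).
Local Notation h := (mesh R N).
Local Notation rvec := 'cV[R]_(N.*2.+1).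
Local Notation M := (massR R N).
Local Notation S := (stiffR R N).

Lemma dotRC (F G : rvec) : dotR F G = dotR G F.
Proof. by apply: eq_bigr => i _; rewrite mulrC. Qed.

Lemma dotRDr (F G H : rvec) : dotR F (G + H) = dotR F G + dotR F H.
Proof. by rewrite -big_split /=; apply: eq_bigr => i _; rewrite mxE mulrDr. Qed.

Lemma dotRZr (F G : rvec) (c : R) : dotR F (c *: G) = c * dotR F G.
Proof. by rewrite mulr_sumr; apply: eq_bigr => i _; rewrite mxE mulrCA. Qed.

Lemma dotR0 (F : rvec) : dotR F 0 = 0.
Proof. by rewrite /dotR big1 // => i _; rewrite mxE mulr0. Qed.

Lemma dotR_sumr (I : finType) (F : rvec) (c : I -> R) (G : I -> rvec) :
  dotR F (\sum_i c i *: G i) = \sum_i c i * dotR F (G i).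
Proof.
elim/big_rec2 : _ => [|i x y _ <-]; first exact: dotR0.
by rewrite dotRDr dotRZr.
Qed.

Lemma dotR_mul (A : 'M[R]_(N.*2.+1)) (F G : rvec) :
  dotR F (A *m G) = \sum_i \sum_j A i j * (F i 0 * G j 0).
Proof.
apply: eq_bigr => i _; rewrite mxE mulr_sumr; apply: eq_bigr => j _; ring.
Qed.

Lemma within_continuous1D (A : set R) (f g : R -> R) :
  {within A, continuous f} -> {within A, continuous g} ->
  {within A, continuous (fun t => f t + g t)}.
Proof. by move=> cf cg x; exact: cvgD (cf x) (cg x). Qed.

Lemma within_continuous1M (A : set R) (f g : R -> R) :
  {within A, continuous f} -> {within A, continuous g} ->
  {within A, continuous (fun t => f t * g t)}.
Proof. by move=> cf cg x; exact: cvgM (cf x) (cg x). Qed.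

Lemma within_continuous_sqr_div (A : set R) (f : R -> R) (c : R) :
  {within A, continuous f} -> {within A, continuous (fun t => (f t / c) ^+ 2)}.
Proof.
move=> cf; under eq_fun do rewrite expr2.
by apply: within_continuous1M; apply: within_continuous1M => // x;
  exact: cst_continuous.
Qed.

Lemma within_continuous1_sum (A : set R) (I : Type) (r : seq I) (F : I -> R -> R) :
  (forall i, {within A, continuous (F i)}) ->
  {within A, continuous (fun t => \sum_(i <- r) F i t)}.
Proof.
move=> cF; elim: r => [|i r IH].
  rewrite (_ : (fun _ => _) = cst 0); first by move=> x; exact: cst_continuous.
  by apply/funext => x; rewrite big_nil.
rewrite (_ : (fun _ => _) = (fun x => F i x + \sum_(j <- r) F j x)).
  exact: within_continuous1D.
by apply/funext => x; rewrite big_cons.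
Qed.

Lemma is_deriv_on_within_continuous (a b : R) (f df : R -> R) :
  (forall t, t \in `[a, b] -> is_deriv_on `[a, b] f t (df t)) ->
  {within `[a, b], continuous f}.
Proof.
move=> fE; apply/subspace_continuousP => x xab.
by apply: is_deriv_on_continuous; apply: fE.
Qed.

Lemma is_deriv_onB (A : set R) (f g : R -> R) (x l l' : R) : A x ->
  is_deriv_on A f x l -> is_derive x 1 g l' ->
  is_deriv_on A (fun t => f t - g t) x (l - l').
Proof.
move=> Ax df dg.
have {}dg : is_deriv_on A g x l' by apply: is_derive_is_deriv_on dg.
rewrite /is_deriv_on (_ : (fun y => _) =
  (fun y => (f y - f x) / (y - x) - (g y - g x) / (y - x))); first exact: cvgB.
by apply/funext => y; rewrite -mulrBl; congr (_ / _); ring.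
Qed.

Definition is_sol (T : R) (u v w : R -> rvec) : Prop :=
  forall t, t \in `[0, T] ->
    [/\ forall i, is_deriv_on `[0, T] (fun s => u s i 0) t (v t i 0),
        forall i, is_deriv_on `[0, T] (fun s => v s i 0) t (w t i 0)
      & M *m w t + S *m u t = 0].

(* The energy is conserved and positive definite. *)
Lemma is_sol_eq0 (T : R) (u v w : R -> rvec) : 0 < T -> is_sol T u v w ->
  u T = 0 -> v T = 0 -> forall t, t \in `[0, T] -> u t = 0.
Proof.
move=> T0 sol uT vT.
pose en t := dotR (u t) (S *m u t) + dotR (v t) (M *m v t).
have cu i : {within `[0, T], continuous (fun s => u s i 0)}.
  apply: (@is_deriv_on_within_continuous _ _ _ (fun t => v t i 0)).
  by move=> t /sol[].
have cv i : {within `[0, T], continuous (fun s => v s i 0)}.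
  apply: (@is_deriv_on_within_continuous _ _ _ (fun t => w t i 0)).
  by move=> t /sol[].
have enE : en = fun t => \sum_i \sum_j S i j * (u t i 0 * u t j 0) +
    \sum_i \sum_j M i j * (v t i 0 * v t j 0).
  by apply/funext => t; rewrite /en !dotR_mul.
have ccst (c : R) : {within `[0, T], continuous (fun=> c)}.
  by move=> x; exact: cst_continuous.
have cen : {within `[0, T], continuous en}.
  rewrite enE; apply: within_continuous1D; apply: within_continuous1_sum => i;
    apply: within_continuous1_sum => j; apply: within_continuous1M => //;
    exact: within_continuous1M.
have den (t : R) : t \in `]0, T[ -> is_derive t 1 en 0.
  move=> tT; have tT' : t \in `[0, T] by apply: subset_itv_oo_cc tT.
  have [du dv e] := sol t tT'.
  have {}du i := is_deriv_on_is_derive tT (du i).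
  have {}dv i := is_deriv_on_is_derive tT (dv i).
  have z : \sum_i \sum_j S i j * (u t i 0 * v t j 0 + u t j 0 * v t i 0) +
    \sum_i \sum_j M i j * (v t i 0 * w t j 0 + v t j 0 * w t i 0) = 0.
    transitivity (2 * dotR (v t) (M *m w t + S *m u t)); last by rewrite e dotR0 mulr0.
    apply/esym.
    rewrite dotRDr mulrDr addrC; congr (_ + _).
      rewrite mulr_natl mulr2n {2}stiffR_sym !dotR_mul -big_split /=.
      apply: eq_bigr => i _; rewrite -big_split /=; apply: eq_bigr => j _; ring.
    rewrite mulr_natl mulr2n {2}massR_sym !dotR_mul -big_split /=.
    apply: eq_bigr => i _; rewrite -big_split /=; apply: eq_bigr => j _; ring.
  rewrite enE -[X in is_derive _ _ _ X]z; apply: is_derive1D.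
    apply: is_derive1_sum => i; apply: is_derive1_sum => j; apply: is_derive1Z.
    exact: is_derive1M (du i) (du j).
  apply: is_derive1_sum => i; apply: is_derive1_sum => j; apply: is_derive1Z.
  exact: is_derive1M (dv i) (dv j).
(* Zero energy yields v = 0 through definiteness of the mass matrix; u is then constant, hence equal
   to its value 0 at T. *)
have v0 t : t \in `[0, T] -> v t = 0.
  move=> tT; have := zero_deriv_on_cst T0 den cen tT.
  rewrite {2}/en uT vT !mulmx0 !dotR0 addr0 /en => e.
  apply: massR_eq0; apply/eqP; rewrite eq_le massR_ge0 andbT.
  by have := stiffR_ge0 (u t); lra.
move=> t tT; apply/matrixP => i j; rewrite ord1 mxE.
have du (s : R) : s \in `]0, T[ -> is_derive s 1 (fun s => u s i 0) 0.
  move=> sT; have sT' : s \in `[0, T] by apply: subset_itv_oo_cc sT.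
  have [/(_ i) + _ _] := sol s sT'.
  by rewrite v0 // mxE; exact: is_deriv_on_is_derive.
by rewrite (zero_deriv_on_cst T0 du (cu i) tT) uT mxE.
Qed.

Section Modes.
Variables (I : finType) (psi : I -> rvec) (omega : I -> R).
Hypothesis omega_gt0 : forall i, 0 < omega i.
Hypothesis psi_eigen : forall i, S *m psi i = omega i ^+ 2 *: (M *m psi i).

Definition amplitude (T : R) (a b : I -> R) (t : R) (i : I) : R :=
  a i * cos (omega i * (t - T)) + b i / omega i * sin (omega i * (t - T)).

(** Uniqueness takes the place of a diagonalisation: the modal sum solves the same system with the
    same data at T, so [is_sol_eq0] applies to the difference. *)
Lemma is_sol_modes (T : R) (a b : I -> R) (u v w : R -> rvec) :
    0 < T -> is_sol T u v w ->
    u T = \sum_i a i *: psi i -> v T = \sum_i b i *: psi i ->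
  forall t : R, t \in `[0, T] -> u t = \sum_i amplitude T a b t i *: psi i.
Proof.
move=> T0 sol uT vT.
pose A (t : R) (i : I) : R := amplitude T a b t i.
pose A1 (t : R) (i : I) : R := a i * - (omega i * sin (omega i * (t - T))) +
  b i / omega i * (omega i * cos (omega i * (t - T))).
pose A2 (t : R) (i : I) : R := - omega i ^+ 2 * A t i.
have on i : omega i != 0 by rewrite gt_eqF.
have dA (t : R) i : is_derive t 1 (A ^~ i) (A1 t i).
  apply: is_derive1D; apply: is_derive1Z.
    exact: is_derive1_cos_affine.
  exact: is_derive1_sin_affine.
have dA1 (t : R) i : is_derive t 1 (A1 ^~ i) (A2 t i).
  rewrite (_ : A2 t i = a i * - (omega i * (omega i * cos (omega i * (t - T)))) +
    b i / omega i * (omega i * - (omega i * sin (omega i * (t - T))))); last first.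
    by rewrite /A2 /A /amplitude; ring.
  apply: is_derive1D; apply: is_derive1Z; last first.
    by apply: is_derive1Z; exact: is_derive1_cos_affine.
  rewrite -mulrN; under eq_fun do rewrite -mulrN.
  rewrite (_ : (fun y => _) = (fun y => - omega i * sin (omega i * (y - T)))).
    rewrite mulrN -mulNr; apply: is_derive1Z; exact: is_derive1_sin_affine.
  by apply/funext => y; rewrite mulrN mulNr.
pose lin (B : R -> I -> R) t : rvec := \sum_i B t i *: psi i.
have linE B t j : lin B t j 0 = \sum_i psi i j 0 * B t i.
  by rewrite summxE; apply: eq_bigr => i _; rewrite mxE mulrC.
have dlin B dB (t : R) j : (forall i, is_derive t 1 (B ^~ i) (dB t i)) ->
    is_derive t 1 (fun s => lin B s j 0) (lin dB t j 0).
  move=> d; rewrite linE; under eq_fun do rewrite linE.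
  by apply: is_derive1_sum => i; apply: is_derive1Z.
pose u' t := u t - lin A t; pose v' t := v t - lin A1 t; pose w' t := w t - lin A2 t.
have subE (F G : rvec) i : (F - G) i 0 = F i 0 - G i 0 by rewrite !mxE.
have sol' : is_sol T u' v' w'.
  move=> t tT; have [du dv e] := sol t tT; split => [i|i|].
  - rewrite (_ : (fun s => _) = (fun s => u s i 0 - lin A s i 0)); last first.
      by apply/funext => s; rewrite subE.
    rewrite subE; by apply: is_deriv_onB => //; apply: dlin => j; exact: dA.
  - rewrite (_ : (fun s => _) = (fun s => v s i 0 - lin A1 s i 0)); last first.
      by apply/funext => s; rewrite subE.
    rewrite subE; by apply: is_deriv_onB => //; apply: dlin => j; exact: dA1.
  - rewrite /u' /w' !mulmxBr addrACA e add0r -opprD.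
    rewrite (_ : _ + _ = 0) ?oppr0 // !mulmx_sumr -big_split big1 //= => i _.
    by rewrite -!scalemxAr psi_eigen scalerA -scalerDl /A2 mulNr mulrC addNr scale0r.
have A_T i : A T i = a i.
  by rewrite /A /amplitude subrr mulr0 cos0 sin0 mulr1 mulr0 addr0.
have A1_T i : A1 T i = b i.
  by rewrite /A1 subrr mulr0 cos0 sin0 mulr1 !mulr0 oppr0 mulr0 add0r divfK.
have u'T : u' T = 0.
  by rewrite /u' uT /lin; under [X in _ - X]eq_bigr do rewrite A_T; rewrite subrr.
have v'T : v' T = 0.
  by rewrite /v' vT /lin; under [X in _ - X]eq_bigr do rewrite A1_T; rewrite subrr.
move=> t tT; have := is_sol_eq0 T0 sol' u'T v'T tT.
by rewrite /u' => /eqP; rewrite subr_eq0 => /eqP.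
Qed.

Hypothesis omega_inj : injective omega.

Lemma modes_orthogonal i j : i != j -> dotR (psi i) (M *m psi j) = 0.
Proof.
move=> ij; have := stiffR_sym (psi i) (psi j).
rewrite !psi_eigen !dotRZr (massR_sym (psi j)) => /eqP.
rewrite -subr_eq0 -mulrBl mulf_eq0 => /orP[|/eqP //].
rewrite subr_eq0 eqrXn2 // ?(ltW (omega_gt0 _)) // => /eqP /omega_inj e.
by rewrite e eqxx in ij.
Qed.

(** Stated for any matrix acting on the modes as a multiple of M, to serve both halves of the
    energy: k = omega^2 for the stiffness and k = 1 for the mass. *)
Lemma dotR_modes (c : I -> R) (k : I -> R) (A : 'M[R]_(N.*2.+1)) :
    (forall i, A *m psi i = k i *: (M *m psi i)) ->
  dotR (\sum_i c i *: psi i) (A *m (\sum_i c i *: psi i)) =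
  \sum_i k i * c i ^+ 2 * dotR (psi i) (M *m psi i).
Proof.
move=> Ak; rewrite mulmx_sumr.
under [X in dotR _ X]eq_bigr do rewrite -scalemxAr Ak scalerA.
rewrite dotR_sumr; apply: eq_bigr => i _; rewrite dotRC dotR_sumr (bigD1 i) //= big1.
  by rewrite addr0 (dotRC (M *m _)); ring.
by move=> j ji; rewrite dotRC modes_orthogonal ?mulr0 // eq_sym.
Qed.

Variables (T g K : R) (l : 'I_(N.*2.+1)).
Hypothesis T0 : 0 < T.
Hypothesis gT : 2 * pi < g * T.
Hypothesis gapB : forall i j, i != j -> g <= `|omega i - omega j|.
Hypothesis gapD : forall i j, g <= omega i + omega j.
Hypothesis K0 : 0 < K.
Hypothesis psi_boundary : forall i,
  (omega i * h) ^+ 2 * dotR (psi i) (M *m psi i) <= K * psi i l 0 ^+ 2.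

Lemma real_observability (a b : I -> R) (u v w : R -> rvec) :
    is_sol T u v w ->
    u T = \sum_i a i *: psi i -> v T = \sum_i b i *: psi i ->
  dotR (u T) (S *m u T) + dotR (v T) (M *m v T) <=
  2 * K / ingham_const T g *
    \int[@lebesgue_measure R]_(t in `[0, T]) (u t l 0 / h) ^+ 2.
Proof.
move=> sol uT vT; have h0 := mesh_gt0 R N.
have uE := is_sol_modes T0 sol uT vT.
pose al i := a i * psi i l 0 / h; pose be i := b i / omega i * psi i l 0 / h.
have ing := ingham T al be T0 gT gapB gapD.
have I0 := ingham_const_gt0 T0 gT.
have -> : \int[@lebesgue_measure R]_(t in `[0, T]) (u t l 0 / h) ^+ 2 =
    \int[@lebesgue_measure R]_(t in `[0, T]) (\sum_i
      (al i * cos (omega i * (t - T)) + be i * sin (omega i * (t - T)))) ^+ 2.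
  apply: eq_Rintegral => t; rewrite inE /= => tT.
  rewrite uE // summxE mulr_suml; congr (_ ^+ 2).
  by apply: eq_bigr => i _; rewrite mxE /amplitude /al /be; ring.
move: ing; set Int := (X in _ <= X -> _) => ing.
rewrite mulrAC ler_pdivlMr // mulrC.
apply: (@le_trans _ _ (ingham_const T g * (K * \sum_i (al i ^+ 2 + be i ^+ 2)))); last first.
  rewrite (_ : 2 * K * Int = 2 * K * Int) //.
  have -> : ingham_const T g * (K * \sum_i (al i ^+ 2 + be i ^+ 2)) =
    2 * K * (ingham_const T g * (2^-1 * \sum_i (al i ^+ 2 + be i ^+ 2))) by field.
  by rewrite ler_pM2l // mulr_gt0.
rewrite ler_pM2l // uT vT (dotR_modes _ psi_eigen).
rewrite (@dotR_modes b (fun=> 1)) => [|i]; last by rewrite scale1r.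
rewrite -big_split mulr_sumr /=; apply: ler_sum => i _.
rewrite mul1r -mulrDl.
have := psi_boundary i; have := omega_gt0 i; rewrite /al /be.
move: (omega i) (dotR _ _) (psi i l 0) (a i) (b i) => o m p x y o_gt0 bd.
have -> : K * ((x * p / h) ^+ 2 + (y / o * p / h) ^+ 2) =
    (o ^+ 2 * x ^+ 2 + y ^+ 2) / (o * h) ^+ 2 * (K * p ^+ 2).
  by field; rewrite !gt_eqF.
have q0 : 0 <= (o ^+ 2 * x ^+ 2 + y ^+ 2) / (o * h) ^+ 2.
  exact: divr_ge0 (addr_ge0 (mulr_ge0 (sqr_ge0 _) (sqr_ge0 _)) (sqr_ge0 _)) (sqr_ge0 _).
apply: le_trans (ler_wpM2l q0 bd); rewrite le_eqVlt; apply/orP; left; apply/eqP.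
by field; rewrite !gt_eqF.
Qed.

End Modes.

End RealObservability.

(** * The truncated spectrum *)

Section TruncatedSpectrum.
Variables (R : realType) (N : nat) (eta_a eta_om eta_op gamma K : R).
Hypothesis N_gt0 : (0 < N)%N.
Local Notation h := (mesh R N).
Local Notation rvec := 'cV[R]_(N.*2.+1).
Hypothesis gamma_itv : 0 < gamma <= 1.
Hypothesis speed_a : forall x y : R, 0 <= x -> x <= y -> y <= eta_a ->
  gamma * (y - x) <= lambda_a y - lambda_a x.
Hypothesis speed_o : forall x y : R, eta_op <= x -> x <= y -> y <= eta_om ->
  gamma * (y - x) <= lambda_o x - lambda_o y.
Let kappa (L : R) := (40 + L) / (4 * (10 - L)).
Hypothesis amplitude_a : forall eta : R, 0 <= eta <= eta_a ->
  Lambda_a eta * (1 + kappa (Lambda_a eta) ^+ 2) <= K * sin eta ^+ 2.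
Hypothesis amplitude_o : forall eta : R, eta_op <= eta <= eta_om ->
  Lambda_o eta * (1 + kappa (Lambda_o eta) ^+ 2) <= K * sin eta ^+ 2.
Hypothesis Lambda_a_lt10 : forall eta : R, 0 <= eta <= eta_a -> Lambda_a eta < 10.

Definition wave (k : nat) : R := k%:R * pi * h.

(* [true] stands for the acoustic branch, [false] for the optic one. *)
Definition branch (b : bool) : R -> R := if b then @Lambda_a R else @Lambda_o R.

Definition active (p : bool * nat) : bool :=
  (0 < p.2 <= N)%N &&
  (if p.1 then wave p.2 <= eta_a else eta_op <= wave p.2 <= eta_om).

Definition freq (p : bool * nat) : R := Num.sqrt (branch p.1 (wave p.2)) / h.

Let p0 : 0 < pi :> R := pi_gt0 R.
Let h0 : 0 < h := mesh_gt0 R N.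

(** From N >= 1, h is at most 1/2; this is the range required by [lambda_branch_gap]. *)
Let ph_itv : 0 <= pi * h <= pi / 2.
Proof.
rewrite mulr_ge0 ?(ltW p0) ?(ltW h0) //= ler_pM2l // /mesh lef_pV2 ?posrE ?ltr0n //.
by rewrite ler_nat.
Qed.

(** The lower margin keeps acoustic frequencies away from 0; the upper one keeps the branches apart
    near pi. *)
Lemma wave_itv k : (0 < k <= N)%N -> pi * h <= wave k <= pi - pi * h.
Proof.
move=> /andP[k1 kN]; have e : pi * h * N.+1%:R = pi by rewrite -mulrA meshSN mulr1.
have -> : wave k = pi * h * k%:R by rewrite /wave; ring.
apply/andP; split.
  by rewrite ler_peMr ?mulr_ge0 ?(ltW p0) ?(ltW h0) // ler1n.
rewrite -[X in X - _]e -[X in _ - X]mulr1 -mulrBr ler_pM2l ?mulr_gt0 //.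
by rewrite -natr1 addrK ler_nat.
Qed.

Let wave_pi k : (0 < k <= N)%N -> 0 <= wave k <= pi - pi * h.
Proof.
move=> /wave_itv /andP[k1 ->]; rewrite andbT (le_trans _ k1) //.
by have /andP[] := ph_itv.
Qed.

Let lambda_a_lower k : active (true, k) -> gamma * (pi * h) <= lambda_a (wave k).
Proof.
move=> /andP[kN /= ka]; have /andP[k0 _] := wave_itv kN.
have /andP[w0 _] := wave_pi kN; have /andP[g0 _] := gamma_itv.
have := speed_a (lexx 0) w0 ka; rewrite subr0 {2}/lambda_a Lambda_a_0 sqrtr0 subr0.
by apply: le_trans; rewrite ler_pM2l.
Qed.

Let cross k k' : (0 < k <= N)%N -> (0 < k' <= N)%N ->
  gamma * (pi * h) <= lambda_o (wave k) - lambda_a (wave k').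
Proof.
move=> kN kN'; apply: (@le_trans _ _ (pi * h)).
  have /andP[ph _] := ph_itv; have /andP[_ g1] := gamma_itv.
  by rewrite ler_piMl.
by apply: lambda_branch_gap => //; exact: wave_pi.
Qed.

Let wave_lt k k' : (k < k')%N -> pi * h <= wave k' - wave k.
Proof.
move=> kk; rewrite /wave -!mulrA -mulrBl ler_peMl ?mulr_ge0 ?(ltW p0) ?(ltW h0) //.
by rewrite -natrB ?(ltnW kk) // ler1n subn_gt0.
Qed.

Lemma freq_gap p q : active p -> active q -> p != q ->
  pi * gamma <= `|freq p - freq q|.
Proof.
have /andP[g0 _] := gamma_itv.
case: p q => [b k] [b' k'] ap aq; rewrite /freq -mulrBl normrM normfV (gtr0_norm h0).
rewrite ler_pdivlMr // mulrAC mulrC.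
have [/= kN _] := andP ap; have [/= kN' _] := andP aq.
have /andP[w0 _] := wave_pi kN; have /andP[w0' _] := wave_pi kN'.
have a0 (t : R) : 0 <= lambda_a t by exact: sqrtr_ge0.
have same_a m n : (m < n)%N -> active (true, m) -> active (true, n) ->
    gamma * (pi * h) <= `|lambda_a (wave m) - lambda_a (wave n)|.
  move=> mn /andP[mN _] /andP[_ /= na]; have /andP[wm _] := wave_pi mN.
  have d := wave_lt mn; rewrite distrC (le_trans _ (ler_norm _)) //.
  have wmn : wave m <= wave n by have /andP[] := ph_itv; lra.
  by apply: le_trans (speed_a wm wmn na); rewrite ler_pM2l.
have same_o m n : (m < n)%N -> active (false, m) -> active (false, n) ->
    gamma * (pi * h) <= `|lambda_o (wave m) - lambda_o (wave n)|.
  move=> mn /andP[_ /= /andP[mo _]] /andP[_ /= /andP[_ no]].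
  have d := wave_lt mn; rewrite (le_trans _ (ler_norm _)) //.
  have wmn : wave m <= wave n by have /andP[] := ph_itv; lra.
  by apply: le_trans (speed_o mo wmn no); rewrite ler_pM2l.
rewrite xpair_eqE; case: b b' ap aq => [] [] ap aq /=.
- case: ltngtP => // kk _; first exact: same_a.
  by rewrite distrC; exact: same_a.
- by move=> _; rewrite distrC (le_trans _ (ler_norm _)) //; exact: cross.
- by move=> _; rewrite (le_trans _ (ler_norm _)) //; exact: cross.
- case: ltngtP => // kk _; first exact: same_o.
  by rewrite distrC; exact: same_o.
Qed.

(** This is the gap between a frequency and the opposite of another, the case p = q included.
    Acoustic frequencies already exceed the gap, since [lambda_a] grows from 0 at rate at least
    gamma; optic ones exceed acoustic ones by as much. *)
Lemma freq_sum p q : active p -> active q -> pi * gamma <= freq p + freq q.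
Proof.
case: p q => [b k] [b' k'] ap aq; rewrite /freq -mulrDl ler_pdivlMr // mulrAC mulrC.
have [/= kN _] := andP ap; have [/= kN' _] := andP aq.
have a0 (t : R) : 0 <= lambda_a t by exact: sqrtr_ge0.
have o0' (t : R) : 0 <= lambda_o t by exact: sqrtr_ge0.
case: b b' ap aq => [] [] ap aq /=.
- by apply: (le_trans (lambda_a_lower ap)); rewrite lerDl.
- have := (cross kN' kN, a0 (wave k)).
  by rewrite /lambda_a /lambda_o => -[]; lra.
- have := (cross kN kN', a0 (wave k')).
  by rewrite /lambda_a /lambda_o => -[]; lra.
- have := (cross kN kN, o0' (wave k'), a0 (wave k)).
  by rewrite /lambda_a /lambda_o => -[[]]; lra.
Qed.

Lemma freq_gt0 p : active p -> 0 < freq p.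
Proof.
move=> ap; have /andP[g0 _] := gamma_itv.
have := freq_sum ap ap; have : 0 < pi * gamma by rewrite mulr_gt0.
by lra.
Qed.

Lemma branch_ge0 b eta : 0 <= branch b eta.
Proof.
case: b => /=; first by rewrite Lambda_aE acou_ge0 ?cos2_itv.
by rewrite Lambda_oE (le_trans _ (opti_ge12 (cos2_itv _))).
Qed.

Lemma freq_mesh p : (freq p * h) ^+ 2 = branch p.1 (wave p.2).
Proof. by rewrite /freq divfK ?gt_eqF // sqr_sqrtr // branch_ge0. Qed.

Definition mode_vec (p : bool * nat) : rvec :=
  \col_i mode (wave p.2 / 2) (branch p.1 (wave p.2)) i.+1.

Lemma sin_natmul_pi k : sin (k%:R * pi) = 0 :> R.
Proof.
elim: k => [|k IH]; first by rewrite mul0r sin0.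
by rewrite -natr1 mulrDl mul1r sinDpi IH oppr0.
Qed.

Lemma cos_natmul_pi_sqr k : cos (k%:R * pi) ^+ 2 = 1 :> R.
Proof. by rewrite cos2sin2 sin_natmul_pi expr0n subr0. Qed.

Let wave_end k : N.*2.+2%:R * (wave k / 2) = k%:R * pi.
Proof.
have -> : N.*2.+2%:R = 2 * N.+1%:R :> R.
  by rewrite -doubleS -mul2n natrM.
rewrite /wave (_ : _ * _ = k%:R * pi * (h * N.+1%:R)); last by field.
by rewrite meshSN mulr1.
Qed.

Let branch_neq10 p : active p -> branch p.1 (wave p.2) != 10.
Proof.
case: p => [[] k] /andP[kN /= ka].
  have /andP[w0 _] := wave_pi kN.
  by rewrite lt_eqF // Lambda_a_lt10 // w0.
rewrite gt_eqF // Lambda_oE (lt_le_trans _ (opti_ge12 (cos2_itv _))) //.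
by rewrite ltr_nat.
Qed.

Lemma mode_vec_eigen p : active p ->
  stiffR R N *m mode_vec p = freq p ^+ 2 *: (massR R N *m mode_vec p).
Proof.
move=> ap; rewrite (_ : freq p ^+ 2 = branch p.1 (wave p.2) / h ^+ 2).
  apply: mode_eigen; last by rewrite wave_end sin_natmul_pi.
    case: (p.1); rewrite /= ?Lambda_aE ?Lambda_oE.
      exact: acou_dispersion (cos2_itv _).
    exact: opti_dispersion (cos2_itv _).
  exact: branch_neq10.
by rewrite -freq_mesh; field; rewrite gt_eqF.
Qed.

(** At x_N the phase is k pi - eta, whence the value sin eta up to sign. Squared nodal values are at
    most 1 + kappa^2, so [massR_le] bounds the mass norm and the amplitude bound concludes with K
    doubled. *)
Lemma mode_vec_boundary p (l : 'I_(N.*2.+1)) : active p -> l = N.*2.-1 :> nat ->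
  (freq p * h) ^+ 2 * dotR (mode_vec p) (massR R N *m mode_vec p) <=
  2 * K * mode_vec p l 0 ^+ 2.
Proof.
move=> ap lE; rewrite freq_mesh.
set L := branch p.1 (wave p.2); set eta := wave p.2.
have L0 : 0 <= L by exact: branch_ge0.
have -> : mode_vec p l 0 ^+ 2 = sin eta ^+ 2.
  have lN : l.+1 = N.*2 by rewrite lE prednK // double_gt0.
  rewrite mxE lN /mode odd_double.
  have -> : N.*2%:R * (wave p.2 / 2) = p.2%:R * pi - eta.
    by rewrite -wave_end -[N.*2.+2]addn2 natrD /eta; field.
  by rewrite sinB sin_natmul_pi mul0r sub0r sqrrN exprMn cos_natmul_pi_sqr mul1r.
have LK : L * (1 + kappa L ^+ 2) <= K * sin eta ^+ 2.
  move: ap; rewrite /L /eta; case: (p) => [[] k] /andP[kN /= ka].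
    have /andP[w0 _] := wave_pi kN.
    by apply: amplitude_a; rewrite w0.
  exact: amplitude_o.
have M_le : dotR (mode_vec p) (massR R N *m mode_vec p) <= 2 * (1 + kappa L ^+ 2).
  apply: massR_le => m.
  have k0 : 0 <= kappa L ^+ 2 := sqr_ge0 _.
  have [/andP[m0 mN]|mout] := boolP ((0 < m) && (m <= N.*2.+1))%N; last first.
    rewrite nodal_out ?expr0n ?addr_ge0 //.
    by move: mout; rewrite negb_and -leqNgt -ltnNge leqn0.
  have hm : (m.-1 < N.*2.+1)%N by rewrite prednK.
  have -> : m = (Ordinal hm).+1 by rewrite /= prednK.
  rewrite nodal_ord mxE /mode; set x := _ * (_ / 2).
  have s1 : sin x ^+ 2 <= 1 by rewrite sin2cos2 gerBl sqr_ge0.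
  case: ifP => _; last by rewrite (le_trans s1) // lerDl.
  have c1 : cos (wave p.2 / 2) ^+ 2 <= 1 by have /andP[] := cos2_itv (wave p.2).
  rewrite -/(kappa L); move: (kappa L) k0 => kp k0; rewrite !exprMn -mulrA.
  apply: (@le_trans _ _ (kp ^+ 2)); last by rewrite lerDr.
  by rewrite ler_piMr // -[leRHS]mulr1 ler_pM ?sqr_ge0.
apply: (le_trans (ler_wpM2l L0 M_le)).
by rewrite mulrCA -mulrA ler_pM2l.
Qed.

End TruncatedSpectrum.

(** * Complex solutions *)

Section ComplexVectors.
Variables (R : realType) (N : nat).
Local Notation h := (mesh R N).
Local Notation rvec := 'cV[R]_(N.*2.+1).

Definition re_vec (F : vec R N) : rvec := map_mx (@complex.Re R) F.
Definition im_vec (F : vec R N) : rvec := map_mx (@complex.Im R) F.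
Definition cvec (F : rvec) : vec R N := map_mx (real_complex R) F.

Lemma Re_sum (I : Type) (r : seq I) (F : I -> R[i]) :
  complex.Re (\sum_(i <- r) F i) = \sum_(i <- r) complex.Re (F i).
Proof. by apply: big_morph => // -[a b] [c d]. Qed.

Lemma Im_sum (I : Type) (r : seq I) (F : I -> R[i]) :
  complex.Im (\sum_(i <- r) F i) = \sum_(i <- r) complex.Im (F i).
Proof. by apply: big_morph => // -[a b] [c d]. Qed.

Lemma Re_realM (x : R) (z : R[i]) : complex.Re (x%:C * z) = x * complex.Re z.
Proof. by case: z => a b /=; rewrite mul0r subr0. Qed.

Lemma Im_realM (x : R) (z : R[i]) : complex.Im (x%:C * z) = x * complex.Im z.
Proof. by case: z => a b /=; rewrite mul0r addr0. Qed.

Lemma re_vec_mul (A : 'M[R]_(N.*2.+1)) (F : vec R N) :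
  re_vec (map_mx (real_complex R) A *m F) = A *m re_vec F.
Proof.
apply/matrixP => i j; rewrite !mxE Re_sum; apply: eq_bigr => k _.
by rewrite !mxE Re_realM.
Qed.

Lemma im_vec_mul (A : 'M[R]_(N.*2.+1)) (F : vec R N) :
  im_vec (map_mx (real_complex R) A *m F) = A *m im_vec F.
Proof.
apply/matrixP => i j; rewrite !mxE Im_sum; apply: eq_bigr => k _.
by rewrite !mxE Im_realM.
Qed.

Lemma re_vec_comb (I : finType) (a : I -> R[i]) (psi : I -> rvec) :
  re_vec (\sum_i a i *: cvec (psi i)) = \sum_i complex.Re (a i) *: psi i.
Proof.
apply/matrixP => i j; rewrite mxE !summxE Re_sum; apply: eq_bigr => k _.
by rewrite !mxE mulrC Re_realM mulrC.
Qed.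

Lemma im_vec_comb (I : finType) (a : I -> R[i]) (psi : I -> rvec) :
  im_vec (\sum_i a i *: cvec (psi i)) = \sum_i complex.Im (a i) *: psi i.
Proof.
apply/matrixP => i j; rewrite mxE !summxE Im_sum; apply: eq_bigr => k _.
by rewrite !mxE mulrC Im_realM mulrC.
Qed.

Lemma Re_dotc (F G : vec R N) : complex.Re (dotc F G) =
  dotR (re_vec F) (re_vec G) + dotR (im_vec F) (im_vec G).
Proof.
rewrite /dotc Re_sum -big_split /=; apply: eq_bigr => i _; rewrite !mxE.
by case: (F i 0) (G i 0) => a b [c d] /=; rewrite mulrN opprK.
Qed.

Lemma norm_h1_sqr (F : vec R N) : norm_h1 F ^+ 2 =
  dotR (re_vec F) (stiffR R N *m re_vec F) + dotR (im_vec F) (stiffR R N *m im_vec F).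
Proof.
rewrite /norm_h1 Re_dotc re_vec_mul im_vec_mul !(dotRC (_ *m _)).
by rewrite sqr_sqrtr // addr_ge0 ?stiffR_ge0.
Qed.

Lemma norm_h0_sqr (F : vec R N) : norm_h0 F ^+ 2 =
  dotR (re_vec F) (massR R N *m re_vec F) + dotR (im_vec F) (massR R N *m im_vec F).
Proof.
rewrite /norm_h0 Re_dotc re_vec_mul im_vec_mul !(dotRC (_ *m _)).
by rewrite sqr_sqrtr // addr_ge0 ?massR_ge0.
Qed.

Lemma eigvec_cvec (b : bool) (k : nat) :
  eigvec (@branch R b) N k = ((norm_h0 (eigvec_tilde (@branch R b) N k))^-1)%:C *:
    cvec (mode_vec R N (b, k)).
Proof.
rewrite /eigvec; congr (_ *: _); apply/matrixP => i j; rewrite !mxE /mode /=.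
have e : k%:R * pi * node R N i.+1 = i.+1%:R * (wave R N k / 2).
  by rewrite /node /wave; field.
by rewrite e /wave.
Qed.

Lemma adjoint_solution_re (T : R) (U Ut Utt : R -> vec R N) :
    (forall t, t \in `[0, T] -> forall i,
          is_cderiv_on `[0, T] (fun s => U s i 0) t (Ut t i 0) /\
          is_cderiv_on `[0, T] (fun s => Ut s i 0) t (Utt t i 0)) ->
    (forall t, t \in `[0, T] -> mass R N *m Utt t + stiff R N *m U t = 0) ->
  is_sol T (fun t => re_vec (U t)) (fun t => re_vec (Ut t)) (fun t => re_vec (Utt t)).
Proof.
move=> d e t tT; split => [i|i|].
- have [[+ _] _] := d t tT i; rewrite mxE.
  by under [X in _ -> is_deriv_on _ X _ _]eq_fun do rewrite mxE.
- have [_ [+ _]] := d t tT i; rewrite mxE.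
  by under [X in _ -> is_deriv_on _ X _ _]eq_fun do rewrite mxE.
- rewrite -!re_vec_mul /re_vec -map_mxD.
  have -> := e t tT.
  by apply/matrixP => i j; rewrite !mxE.
Qed.

Lemma adjoint_solution_im (T : R) (U Ut Utt : R -> vec R N) :
    (forall t, t \in `[0, T] -> forall i,
          is_cderiv_on `[0, T] (fun s => U s i 0) t (Ut t i 0) /\
          is_cderiv_on `[0, T] (fun s => Ut s i 0) t (Utt t i 0)) ->
    (forall t, t \in `[0, T] -> mass R N *m Utt t + stiff R N *m U t = 0) ->
  is_sol T (fun t => im_vec (U t)) (fun t => im_vec (Ut t)) (fun t => im_vec (Utt t)).
Proof.
move=> d e t tT; split => [i|i|].
- have [[_ +] _] := d t tT i; rewrite mxE.
  by under [X in _ -> is_deriv_on _ X _ _]eq_fun do rewrite mxE.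
- have [_ [_ +]] := d t tT i; rewrite mxE.
  by under [X in _ -> is_deriv_on _ X _ _]eq_fun do rewrite mxE.
- rewrite -!im_vec_mul /im_vec -map_mxD.
  have -> := e t tT.
  by apply/matrixP => i j; rewrite !mxE.
Qed.

Hypothesis N_gt0 : (0 < N)%N.

Let last_ltn : (N.*2.-1 < N.*2.+1)%N.
Proof. by rewrite ltnS (leq_trans (leq_pred _)). Qed.

Let l : 'I_(N.*2.+1) := inord N.*2.-1.

Lemma val_last : l = N.*2.-1 :> nat.
Proof. by rewrite inordK. Qed.

Lemma normc_last_sqr (F : vec R N) :
  ComplexField.Normc.normc (last_node F / h%:C) ^+ 2 =
  (re_vec F l 0 / h) ^+ 2 + (im_vec F l 0 / h) ^+ 2.
Proof.
rewrite /last_node -/l !mxE.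
have -> : (h%:C)^-1 = (h^-1)%:C by rewrite -fmorphV.
rewrite mulrC; have := (Re_realM h^-1 (F l 0), Im_realM h^-1 (F l 0)).
case: (_%:C * _) => a b /= [-> ->].
rewrite sqr_sqrtr ?addr_ge0 ?sqr_ge0 //.
by rewrite ![h^-1 * _]mulrC.
Qed.

Lemma norm_obs_sqr (F : vec R N) : norm_euclid (obs R N *m F) ^+ 2 =
  (re_vec F l 0 / h) ^+ 2 + (im_vec F l 0 / h) ^+ 2.
Proof.
pose A : 'M[R]_(N.*2.+1) :=
  \matrix_(i, j) if (i.+1 == N.*2.+1) && (j.+1 == N.*2) then - h^-1 else 0.
have -> : obs R N = map_mx (real_complex R) A.
  apply/matrixP => i j; rewrite !mxE; case: ifP => _; last by rewrite rmorph0.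
  by rewrite rmorphN.
have AE (G : rvec) : dotR (A *m G) (A *m G) = (G l 0 / h) ^+ 2.
  have AG i : (A *m G) i 0 = if i == ord_max then - (G l 0 / h) else 0.
    rewrite mxE (bigD1 l) //= big1 ?addr0 => [|j jl]; rewrite mxE.
      rewrite val_last prednK ?double_gt0 // eqxx andbT eqSS.
      by rewrite -val_eqE /=; case: ifP; rewrite ?mul0r // mulNr mulrC.
    rewrite (_ : (j.+1 == N.*2) = false) ?andbF ?mul0r //.
    apply/negbTE; apply: contraNneq jl => jN; apply/eqP/val_inj.
    by rewrite /= val_last; exact: (congr1 predn jN).
  rewrite /dotR (bigD1 ord_max) //= !AG eqxx big1 ?addr0 ?mulrNN ?expr2 // => i im.
  by rewrite AG (negbTE im) mul0r.
rewrite /norm_euclid Re_dotc re_vec_mul im_vec_mul !AE sqr_sqrtr //.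
by rewrite addr_ge0 ?sqr_ge0.
Qed.

End ComplexVectors.

(** * Generators of the truncated space *)

Section TruncatedSpace.
Variables (R : realType) (N : nat) (eta_a eta_om eta_op : R).

(** The boolean tag distinguishes acoustic and optic modes of equal k; the list is then free of
    repetitions and its positions index distinct modes. *)
Definition active_seq : seq (bool * nat) :=
  [seq (true, k) | k <- iota 1 N & wave R N k <= eta_a] ++
  [seq (false, k) | k <- iota 1 N & eta_op <= wave R N k <= eta_om].

Lemma active_seq_uniq : uniq active_seq.
Proof.
rewrite cat_uniq !map_inj_uniq ?filter_uniq ?iota_uniq ?andbT //=;
  try by move=> ? ? [].
by apply/hasPn => _ /mapP[k _ ->]; apply/negP => /mapP[].
Qed.

Lemma active_seqP p : p \in active_seq -> active N eta_a eta_om eta_op p.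
Proof.
rewrite mem_cat => /orP[] /mapP[k]; rewrite mem_filter mem_iota => /andP[w kN] ->.
  by rewrite /active /= w andbT; case/andP: kN => ->; rewrite add1n ltnS.
by rewrite /active /= w andbT; case/andP: kN => ->; rewrite add1n ltnS.
Qed.

Definition active_mode (i : 'I_(size active_seq)) : bool * nat :=
  nth (true, 0%N) active_seq i.

Lemma active_modeP i : active N eta_a eta_om eta_op (active_mode i).
Proof. by apply: active_seqP; rewrite mem_nth. Qed.

Lemma active_mode_neq i j : i != j -> active_mode i != active_mode j.
Proof. by rewrite /active_mode nth_uniq ?active_seq_uniq. Qed.

Lemma trunc_space_comb (F : vec R N) : F \in trunc_space N eta_a eta_om eta_op ->
  exists a : 'I_(size active_seq) -> R[i],
    F = \sum_i a i *: cvec (mode_vec R N (active_mode i)).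
Proof.
pose f (p : bool * nat) := eigvec (@branch R p.1) N p.2.
have -> : trunc_space N eta_a eta_om eta_op = <<map f active_seq>>%VS.
  by rewrite map_cat span_cat -!map_comp.
move=> /(coord_span (X := in_tuple _)) FE.
pose c (p : bool * nat) : R[i] := ((norm_h0 (eigvec_tilde (@branch R p.1) N p.2))^-1)%:C.
have sz : size (map f active_seq) = size active_seq by rewrite size_map.
exists (fun i => coord (in_tuple (map f active_seq)) (cast_ord (esym sz) i) F *
  c (active_mode i)).
rewrite {1}FE (reindex (cast_ord (esym sz))) /=; last first.
  by exists (cast_ord sz) => i _; rewrite ?cast_ordK ?cast_ordKV.
apply: eq_bigr => i _; rewrite -scalerA; congr (_ *: _).
rewrite (nth_map (true, 0%N)) //= -/(active_mode i) /f.
by case: (active_mode i) => b k /=; rewrite eigvec_cvec.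
Qed.

End TruncatedSpace.

(** * Observability with a constant independent of the mesh *)

Theorem theorem5p1 (R : realType) (La_p Lo_m Lo_p : R)
    (hLa_p : 0 < La_p < 10) (hLo_m : 12 < Lo_m < 60) (hLo_p : 12 < Lo_p < 60)
    (hLo : Lo_m <= Lo_p) (T : R)
    (hT : Tstar (Lambda_a_inv La_p) (Lambda_o_inv Lo_m) (Lambda_o_inv Lo_p) < T) :
  exists C : R, 0 < C /\
    forall (N : nat) (hN : (1 <= N)%N) (U0 U1 : vec R N) (U : R -> vec R N),
      let Th := trunc_space N (Lambda_a_inv La_p)
                  (Lambda_o_inv Lo_m) (Lambda_o_inv Lo_p) in
      U0 \in Th -> U1 \in Th ->
      adjoint_solution T U0 U1 U ->
      energy U0 U1 <=
        C * \int[@lebesgue_measure R]_(t in `[0, T])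
              (norm_euclid (obs R N *m U t) ^+ 2) /\
      C * \int[@lebesgue_measure R]_(t in `[0, T])
            (norm_euclid (obs R N *m U t) ^+ 2) =
        C * \int[@lebesgue_measure R]_(t in `[0, T])
              (ComplexField.Normc.normc (last_node (U t) / (mesh R N)%:C) ^+ 2).
Proof.
have p0 : 0 < pi :> R := pi_gt0 R.
have [gamma [/andP[g0 g1] gT speed_a speed_o]] :=
  uniform_group_velocity hLa_p hLo_m hLo_p hLo hT.
have [K [K0 [ampl_a ampl_o]]] := uniform_amplitude hLa_p hLo_m hLo_p hLo.
have T0 : 0 < T by rewrite -(pmulr_rgt0 _ g0); lra.
(* Ingham's condition for the gap [pi * gamma]. *)
have gpT : 2 * pi < pi * gamma * T by rewrite mulrC -mulrA ltr_pM2l.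
have I0 := ingham_const_gt0 T0 gpT.
have K20 : 0 < 2 * K by rewrite mulr_gt0.
have La_itv : 0 <= La_p < 10 by have /andP[/ltW-> ->] := hLa_p.
have [ea0 eapi eaE] := Lambda_a_invP La_itv.
have Lambda_a_lt10 eta : 0 <= eta <= Lambda_a_inv La_p -> Lambda_a eta < 10.
  move=> /andP[e0 e1]; have /andP[_ L10] := hLa_p; apply: le_lt_trans L10.
  have C1 : cos (eta / 2) ^+ 2 <= 1 by have /andP[] := cos2_itv eta.
  have CC : cos (Lambda_a_inv La_p / 2) ^+ 2 <= cos (eta / 2) ^+ 2.
    have c0 : 0 <= cos (Lambda_a_inv La_p / 2) by apply: cos_ge0_pihalf; lra.
    have cc : cos (Lambda_a_inv La_p / 2) <= cos (eta / 2).
      by apply: cos_half_mono => //; exact: ltW.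
    by rewrite lerXn2r ?nnegrE // (le_trans c0).
  by rewrite -[leRHS]eaE !Lambda_aE; exact: acou_anti (sqr_ge0 _) CC C1.
have gamma_itv : 0 < gamma <= 1 by rewrite g0.
(* [real_observability] is used with 2 K, from [mode_vec_boundary], and gives 2 * (2 K) over the
   Ingham constant; the factor 1/2 of the energy halves it. Nothing here depends on N. *)
exists (2 * K / ingham_const T (pi * gamma)); split; first by rewrite divr_gt0.
move=> N N0 U0 U1 U Th U0T U1T [Ut [Utt [dU eqU UT UtT]]].
have norm_eq : (fun t => norm_euclid (obs R N *m U t) ^+ 2) =
    (fun t => ComplexField.Normc.normc (last_node (U t) / (mesh R N)%:C) ^+ 2).
  by apply/funext => t; rewrite norm_obs_sqr // normc_last_sqr.
split; last by rewrite norm_eq.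
set l : 'I_(N.*2.+1) := inord N.*2.-1.
have lE : l = N.*2.-1 :> nat := val_last N.
have [a aE] := trunc_space_comb U0T; have [b bE] := trunc_space_comb U1T.
set md := @active_mode R N _ _ _ in a aE b bE.
have act := @active_modeP R N (Lambda_a_inv La_p) (Lambda_o_inv Lo_m) (Lambda_o_inv Lo_p).
pose omega i := freq R N (md i).
have gapB i j : i != j -> pi * gamma <= `|omega i - omega j|.
  move=> ij.
  exact (freq_gap N0 gamma_itv speed_a speed_o (act i) (act j) (active_mode_neq ij)).
have gapD i j : pi * gamma <= omega i + omega j by
  exact (freq_sum N0 gamma_itv speed_a (act i) (act j)).
have omega_gt0 i : 0 < omega i by
  exact (freq_gt0 N0 gamma_itv speed_a (act i)).
have omega_inj : injective omega.
  move=> i j e; apply/eqP; apply: contraT => /gapB.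
  by rewrite e subrr normr0 leNgt mulr_gt0.
have eigen i := mode_vec_eigen N0 Lambda_a_lt10 (act i).
have bdry i := mode_vec_boundary N0 ampl_a ampl_o (act i) lE.
have solR := adjoint_solution_re dU eqU.
have solI := adjoint_solution_im dU eqU.
have reU : re_vec (U T) = \sum_i complex.Re (a i) *: mode_vec R N (md i).
  by rewrite UT aE re_vec_comb.
have imU : im_vec (U T) = \sum_i complex.Im (a i) *: mode_vec R N (md i).
  by rewrite UT aE im_vec_comb.
have reUt : re_vec (Ut T) = \sum_i complex.Re (b i) *: mode_vec R N (md i).
  by rewrite UtT bE re_vec_comb.
have imUt : im_vec (Ut T) = \sum_i complex.Im (b i) *: mode_vec R N (md i).
  by rewrite UtT bE im_vec_comb.
have obsR := real_observability omega_gt0 eigen omega_inj T0 gpT gapB gapD K20 bdry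
  solR reU reUt.
have obsI := real_observability omega_gt0 eigen omega_inj T0 gpT gapB gapD K20 bdry
  solI imU imUt.
(* Integrability of both parts, by continuity of the solution, allows the integral of the squared
   modulus to be split. *)
have int_re : (@lebesgue_measure R).-integrable `[0, T]
    (EFin \o (fun t => (re_vec (U t) l 0 / mesh R N) ^+ 2)).
  apply: continuous_integrable_itv.
  apply: within_continuous_sqr_div.
  apply: (@is_deriv_on_within_continuous _ _ _ _ (fun t => re_vec (Ut t) l 0)).
  by move=> t /solR[].
have int_im : (@lebesgue_measure R).-integrable `[0, T]
    (EFin \o (fun t => (im_vec (U t) l 0 / mesh R N) ^+ 2)).
  apply: continuous_integrable_itv.
  apply: within_continuous_sqr_div.
  apply: (@is_deriv_on_within_continuous _ _ _ _ (fun t => im_vec (Ut t) l 0)).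
  by move=> t /solI[].
have -> : (fun t => norm_euclid (obs R N *m U t) ^+ 2) =
    (fun t => (re_vec (U t) l 0 / mesh R N) ^+ 2 + (im_vec (U t) l 0 / mesh R N) ^+ 2).
  by apply/funext => t; rewrite norm_obs_sqr.
rewrite RintegralD // /energy norm_h1_sqr norm_h0_sqr -UT -UtT.
rewrite mulrDr; move: obsR obsI.
rewrite (_ : 2 * (2 * K) / _ = 2 * (2 * K / ingham_const T (pi * gamma))); last by ring.
move: (2 * K / _) => c; move: (Rintegral _ _ _) (Rintegral _ _ _) => x y.
by rewrite -!mulrA; lra.
Qed.
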